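(* Let $A$ be a semiperfect noetherian ring with Jacobson radical $J$ and set $A_0=A/J$. (1) If $\operatorname{gl\,dim}A$ is finite, then $\operatorname{inj\,dim}_A\Omega^d(A_0)=\operatorname{gl\,dim}A$ for $d=\operatorname{gl\,dim}A$. (2) If $A$ is Iwanaga-Gorenstein and of infinite global dimension, then $\operatorname{inj\,dim}_A\Omega^n(A_0)=\infty$ for every $n\ge 0$. (3) If $A$ has finitistic injective dimension at most one, then $\operatorname{inj\,dim}_A\Omega^n(A_0)=\operatorname{gl\,dim}A$ for every $n\ge 0$ with $\Omega^n(A_0)\neq 0$.
   Context: Rings are associative with unit; noetherian means left and right noetherian. A ring $A$ is semiperfect if every finitely generated (left or right) $A$-module has a projective cover. Modules are left modules. For a finitely generated $A$-module $M$, $\Omega^n(M)$ denotes the $n$-th syzygy of $M$ in its minimal projective resolution (built from projective covers), with $\Omega^0(M)=M$. A ring $A$ is Iwanaga-Gorenstein if it is noetherian on both sides and has finite injective dimension as a left and as a right module over itself. The finitistic injective dimension of $A$ is the supremum of $\operatorname{inj\,dim}_A M$ over finitely generated $A$-modules $M$ with $\operatorname{inj\,dim}_A M<\infty$. *)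

(* Defs.v *)
From HB Require Import structures.
From mathcomp Require Import all_boot all_order all_algebra.
From mathcomp Require Import boolp classical_sets functions.

Set Implicit Arguments.
Unset Strict Implicit.
Unset Printing Implicit Defensive.

Import GRing.Theory.
Local Open Scope ring_scope.
Local Open Scope classical_set_scope.

(* [Some n] is the number n and [None] is infinity. *)
Definition enat := option nat.
Definition infty : enat := None.

Definition le_enat (x y : enat) : bool :=
  match x, y with
  | _, None => true
  | None, Some _ => false
  | Some m, Some n => (m <= n)%N
  end.

Definition inf_nat (S : set nat) : enat :=
  if pselect (exists n, `[< S n >]) is left exS then Some (ex_minn exS)
  else infty.

(* The supremum: the least natural upper bound if there is one, and infinity
   otherwise.  The supremum of the empty set is 0. *)
Definition sup_enat (S : set enat) : enat :=
  inf_nat [set n | forall x, S x -> le_enat x (Some n)].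

Lemma inf_natP (S : set nat) (n : nat) :
  inf_nat S = Some n <-> S n /\ (forall m, S m -> (n <= m)%N).
Proof.
rewrite /inf_nat; case: pselect => [exS|nS]; last first.
  by split=> // -[Sn _]; case: nS; exists n; apply/asboolP.
case: ex_minnP => m /asboolP Sm minm; split=> [[<-]|[Sn minn]].
  by split=> // k Sk; apply: minm; apply/asboolP.
by congr Some; apply/eqP; rewrite eqn_leq minn // andbT minm //; apply/asboolP.
Qed.

Lemma inf_nat_infty (S : set nat) :
  inf_nat S = infty <-> (forall n, ~ S n).
Proof.
rewrite /inf_nat; case: pselect => [exS|nS]; split=> //.
  by move=> none; have [n /asboolP /none] := exS.
by move=> _ n Sn; apply: nS; exists n; apply/asboolP.
Qed.

(* Modules are left modules.  Right A-modules are the left modules over the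
   opposite ring A^c; A^o is the regular left module of A. *)

Section Modules.
Variable A : pzRingType.

Definition submodule (M : lmodType A) (N : set M) : Prop :=
  [/\ N 0, forall x y, N x -> N y -> N (x + y)
    & forall (a : A) x, N x -> N (a *: x)].

Definition fg_submodule (M : lmodType A) (N : set M) : Prop :=
  exists (n : nat) (g : 'I_n -> M),
    N = [set x | exists c : 'I_n -> A, x = \sum_(i < n) c i *: g i].

Definition fin_gen (M : lmodType A) : Prop := fg_submodule [set: M].

Definition zero_module (M : lmodType A) : Prop := forall x : M, x = 0.

Definition ker (M N : lmodType A) (f : {linear M -> N}) : set M :=
  [set x | f x = 0].

Definition surj (M N : lmodType A) (f : {linear M -> N}) : Prop :=
  range f = [set: N].

Definition exact (M1 M2 M3 : lmodType A)
  (f : {linear M1 -> M2}) (g : {linear M2 -> M3}) : Prop := range f = ker g.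

Definition projective (P : lmodType A) : Prop :=
  forall (M N : lmodType A) (g : {linear M -> N}) (f : {linear P -> N}),
    surj g -> exists h : {linear P -> M}, forall x, g (h x) = f x.

Definition injective_module (E : lmodType A) : Prop :=
  forall (M N : lmodType A) (i : {linear M -> N}) (f : {linear M -> E}),
    injective i -> exists h : {linear N -> E}, forall x, h (i x) = f x.

Definition superfluous (M : lmodType A) (K : set M) : Prop :=
  forall N : set M, submodule N ->
    (forall x, exists y z, [/\ K y, N z & x = y + z]) -> N = [set: M].

Definition projective_cover (P M : lmodType A) (p : {linear P -> M}) : Prop :=
  [/\ projective P, surj p & superfluous (ker p)].

Definition inj_resolution_le (M : lmodType A) (n : nat) : Prop :=
  exists (E : nat -> lmodType A) (e : {linear M -> E 0%N})
         (d : forall i, {linear E i -> E i.+1}),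
    [/\ injective e, exact e (d 0%N), forall i, exact (d i) (d i.+1),
        forall i, injective_module (E i)
      & forall i, (n < i)%N -> zero_module (E i)].

Definition proj_resolution_le (M : lmodType A) (n : nat) : Prop :=
  exists (P : nat -> lmodType A) (e : {linear P 0%N -> M})
         (d : forall i, {linear P i.+1 -> P i}),
    [/\ surj e, exact (d 0%N) e, forall i, exact (d i.+1) (d i),
        forall i, projective (P i)
      & forall i, (n < i)%N -> zero_module (P i)].

(* With these conventions the zero module has both dimensions equal to 0. *)
Definition inj_dim (M : lmodType A) : enat := inf_nat (inj_resolution_le M).

Definition proj_dim (M : lmodType A) : enat := inf_nat (proj_resolution_le M).

Definition isomorphic (M N : lmodType A) : Prop :=
  exists f : {linear M -> N}, bijective f.

(* [syzygy n M K] says that K is (a copy of) the n-th syzygy of M: K is the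
   kernel of a projective cover of the preceding syzygy.  Syzygies are only
   determined up to isomorphism, whence a relation. *)
Fixpoint syzygy (n : nat) (M K : lmodType A) : Prop :=
  if n is m.+1 then
    exists (L P : lmodType A) (p : {linear P -> L}) (i : {linear K -> P}),
      [/\ syzygy m M L, projective_cover p, injective i & exact i p]
  else isomorphic M K.

End Modules.

Definition gl_dim (A : pzRingType) : enat :=
  sup_enat [set x | exists M : lmodType A, x = proj_dim M].

Definition fin_inj_dim (A : pzRingType) : enat :=
  sup_enat [set x | exists M : lmodType A,
                      [/\ fin_gen M, inj_dim M <> infty & x = inj_dim M]].

(* The submodules of A^o are the left ideals of A. *)
Definition left_noetherian (A : pzRingType) : Prop :=
  forall I : set A^o, submodule I -> fg_submodule I.

Definition noetherian (A : pzRingType) : Prop :=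
  left_noetherian A /\ left_noetherian A^c.

Definition left_semiperfect (A : pzRingType) : Prop :=
  forall M : lmodType A, fin_gen M ->
    exists (P : lmodType A) (p : {linear P -> M}), projective_cover p.

Definition semiperfect (A : pzRingType) : Prop :=
  left_semiperfect A /\ left_semiperfect A^c.

Definition iwanaga_gorenstein (A : pzRingType) : Prop :=
  [/\ noetherian A, inj_dim (A^o : lmodType A) <> infty
    & inj_dim ((A^c)^o : lmodType A^c) <> infty].

Section Radical.
Variable A : pzRingType.

Definition maximal_left_ideal (I : set A^o) : Prop :=
  [/\ submodule I, I <> [set: A^o]
    & forall K : set A^o, submodule K -> I `<=` K -> K = I \/ K = [set: A^o]].

Definition in_jacobson (x : A^o) : Prop :=
  forall I, maximal_left_ideal I -> I x.

Definition jacobson : {pred A^o} := fun x => `[< in_jacobson x >].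

Lemma jacobsonP (x : A^o) : reflect (in_jacobson x) (x \in jacobson).
Proof. exact: asboolP. Qed.

Fact jacobson_submod_closed : subsemimod_closed jacobson.
Proof.
split; first split.
- by apply/jacobsonP => I [[]].
- move=> x y /jacobsonP Jx /jacobsonP Jy; apply/jacobsonP => I maxI.
  by have [[_ ID _] _ _] := maxI; apply: ID; [exact: Jx | exact: Jy].
- move=> a x /jacobsonP Jx; apply/jacobsonP => I maxI.
  by have [[_ _ IZ] _ _] := maxI; apply: IZ; exact: Jx.
Qed.

HB.instance Definition _ :=
  GRing.isSubmodClosed.Build A A^o jacobson jacobson_submod_closed.

Definition mod_jacobson := Quotient.quot jacobson.

HB.instance Definition _ := GRing.Zmodule.on mod_jacobson.

Definition pi_jacobson (x : A^o) : mod_jacobson :=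
  (\pi_(Quotient.quot jacobson) x)%qT.

Definition mod_jacobson_scale (a : A) (x : mod_jacobson) : mod_jacobson :=
  pi_jacobson (a *: (repr x : A^o)).

Lemma pi_jacobson_eq (x y : A^o) :
  pi_jacobson x = pi_jacobson y <-> in_jacobson (x - y).
Proof.
split=> [/eqP|/jacobsonP Jxy]; last by apply/eqP; rewrite -Quotient.idealrBE.
by rewrite -Quotient.idealrBE => /jacobsonP.
Qed.

Lemma repr_jacobsonK (x : mod_jacobson) : pi_jacobson (repr x) = x.
Proof. exact: reprK. Qed.

Lemma pi_jacobson_surj (x : mod_jacobson) : exists y, pi_jacobson y = x.
Proof. by exists (repr x); exact: repr_jacobsonK. Qed.

Lemma pi_jacobsonD (x y : A^o) :
  pi_jacobson (x + y) = pi_jacobson x + pi_jacobson y.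
Proof. exact: Quotient.pi_add. Qed.

Lemma pi_jacobson_scale (a : A) (x : A^o) :
  pi_jacobson (a *: x) = mod_jacobson_scale a (pi_jacobson x).
Proof.
apply/pi_jacobson_eq; rewrite -scalerBr; apply/jacobsonP/rpredZ/jacobsonP.
by apply/pi_jacobson_eq; rewrite repr_jacobsonK.
Qed.

Fact mod_jacobson_scaleA a b v :
  mod_jacobson_scale a (mod_jacobson_scale b v) = mod_jacobson_scale (a * b) v.
Proof.
have [x <-] := pi_jacobson_surj v.
by rewrite -!pi_jacobson_scale scalerA.
Qed.

Fact mod_jacobson_scale1 : left_id 1 mod_jacobson_scale.
Proof.
by move=> v; have [x <-] := pi_jacobson_surj v; rewrite -pi_jacobson_scale scale1r.
Qed.

Fact mod_jacobson_scaleDr : right_distributive mod_jacobson_scale +%R.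
Proof.
move=> a u v; have [x <-] := pi_jacobson_surj u.
have [y <-] := pi_jacobson_surj v.
by rewrite -pi_jacobsonD -!pi_jacobson_scale scalerDr pi_jacobsonD.
Qed.

Fact mod_jacobson_scaleDl v : {morph mod_jacobson_scale^~ v : a b / a + b}.
Proof.
move=> a b /=; have [x <-] := pi_jacobson_surj v.
by rewrite -!pi_jacobson_scale scalerDl pi_jacobsonD.
Qed.

HB.instance Definition _ := GRing.Zmodule_isLmodule.Build A mod_jacobson
  mod_jacobson_scaleA mod_jacobson_scale1 mod_jacobson_scaleDr
  mod_jacobson_scaleDl.

End Radical.

(* Main.v *)
Require Import Defs.
From HB Require Import structures.
From mathcomp Require Import all_boot all_order all_algebra.
From mathcomp Require Import boolp classical_sets functions.
From mathcomp Require Import zify.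

(* Write J for the radical and A_0 = A/J.  A module W whose annihilator is
   exactly J detects projective dimension: maps from a projective P to W kill
   JP, hence kill superfluous submodules, so Ext^(m+1)(Y, W) is the group of
   maps from the next minimal syzygy of a finitely generated Y to W, and such a
   group vanishes only if the syzygy does.  Therefore inj.dim W <= m implies
   gl.dim A <= m, by Baer's criterion.  This applies to W = A_0 and also to the
   character dual Hom(A_0, Q/Z) of the right module A_0; dualizing projective
   resolutions into injective ones and passing once from left to right and
   once back shows that proj.dim A_0 = gl.dim A.

   (1) The n-th syzygy N of A_0, if nonzero, has inj.dim N >= n, as otherwise
   the identity of N would extend to the projective cover containing N as a
   superfluous submodule; and N is nonzero for n = gl.dim A.
   (2) If A and N have finite injective dimension, so do the projective modules
   of the minimal resolution and then, going down one syzygy at a time, A_0.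
   (3) If inj.dim N is finite then it is at most 1, hence n <= 1.  For n = 0 use
   W = A_0.  For n = 1 the vanishing of Ext^1(N, N) forces N to be projective,
   whence proj.dim A_0 <= 1. *)

Set Implicit Arguments.
Unset Strict Implicit.
Unset Printing Implicit Defensive.

Import Order.TTheory GRing.Theory Num.Theory.
Local Open Scope ring_scope.

(** * Submodules, quotients and short exact sequences *)

Section Submodules.
Variable A : pzRingType.

Definition linear_of (M N : lmodType A) (f : M -> N) (fL : linear f) :
  {linear M -> N} := HB.pack f (GRing.isLinear.Build A M N *:%R f fL).

Lemma submoduleN (M : lmodType A) (N : set M) x :
  submodule N -> N x -> N (- x).
Proof. by case=> _ _ NZ Nx; rewrite -scaleN1r; exact: NZ. Qed.

Lemma submoduleB (M : lmodType A) (N : set M) x y :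
  submodule N -> N x -> N y -> N (x - y).
Proof.
by move=> sN Nx Ny; have [_ ND _] := sN; apply: ND => //; exact: submoduleN.
Qed.

Lemma submodule_sum (M : lmodType A) (N : set M) (I : finType) (F : I -> M) :
  submodule N -> (forall i, N (F i)) -> N (\sum_i F i).
Proof. by case=> N0 ND _ NF; apply: (big_ind N). Qed.

Lemma submodule_ker (M N : lmodType A) (f : {linear M -> N}) :
  submodule (ker f).
Proof.
split=> [|x y|a x]; rewrite /ker /= ?linear0 //.
  by move=> fx fy; rewrite linearD fx fy addr0.
by move=> fx; rewrite linearZ /= fx scaler0.
Qed.

Lemma submodule_preimage (M N : lmodType A) (f : {linear M -> N}) (S : set N) :
  submodule S -> submodule [set x | S (f x)]%classic.
Proof.
case=> S0 SD SZ; split=> [|x y|a x] /=; first by rewrite linear0.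
  by rewrite linearD; exact: SD.
by rewrite linearZ; exact: SZ.
Qed.

Lemma submodule_image (M N : lmodType A) (f : {linear M -> N}) (S : set M) :
  submodule S -> submodule (f @` S)%classic.
Proof.
case=> S0 SD SZ; split.
- by exists 0; rewrite ?linear0.
- by move=> _ _ [x Sx <-] [y Sy <-]; exists (x + y); [exact: SD | rewrite linearD].
- by move=> a _ [x Sx <-]; exists (a *: x); [exact: SZ | rewrite linearZ].
Qed.

Section Carrier.
Variables (M : lmodType A) (N : set M) (sN : submodule N).

(** The proof is carried as an argument so that the closure instance, which depends on it, can be
    attached to the predicate. *)
Definition submodule_pred of submodule N : {pred M} := fun x => `[< N x >].
Local Notation S := (submodule_pred sN).

Fact submodule_pred_closed : subsemimod_closed S.
Proof.
case: sN => N0 ND NZ; split; first split.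
- exact/asboolP.
- by move=> x y /asboolP Nx /asboolP Ny; apply/asboolP; exact: ND.
- by move=> a x /asboolP Nx; apply/asboolP; exact: NZ.
Qed.

HB.instance Definition _ :=
  GRing.isSubmodClosed.Build A M S submodule_pred_closed.

Record subm := Subm { subm_val : M; subm_valP : subm_val \in S }.

HB.instance Definition _ := [isSub for subm_val].
HB.instance Definition _ := [Choice of subm by <:].
HB.instance Definition _ := [SubChoice_isSubLmodule of subm by <:].

Definition subm_incl : {linear subm -> M} := linear_of (linearP (val : subm -> M)).

Lemma subm_incl_inj : injective subm_incl.
Proof. exact: val_inj. Qed.

Lemma subm_inclP x : N (subm_incl x).
Proof. by have /asboolP := subm_valP x. Qed.

Lemma subm_incl_surj x : N x -> exists y, subm_incl y = x.
Proof. by move=> /asboolP Nx; exists (@Subm x Nx). Qed.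

Definition quom := Quotient.quot S.
HB.instance Definition _ := GRing.Zmodule.on quom.

Definition quom_proj (x : M) : quom := (\pi_(Quotient.quot S) x)%qT.
Definition quom_scale (a : A) (x : quom) : quom := quom_proj (a *: (repr x : M)).

Lemma quom_projE x y : quom_proj x = quom_proj y <-> N (x - y).
Proof.
by split=> [/eqP|Nxy]; [|apply/eqP]; rewrite -Quotient.idealrBE => *;
  exact/asboolP.
Qed.

Lemma quom_proj_surj (x : quom) : exists y, quom_proj y = x.
Proof. by exists (repr x); exact: reprK. Qed.

Lemma quom_projD x y : quom_proj (x + y) = quom_proj x + quom_proj y.
Proof. exact: Quotient.pi_add. Qed.

Lemma quom_projZ a x : quom_proj (a *: x) = quom_scale a (quom_proj x).
Proof.
apply/quom_projE; rewrite -scalerBr; have [_ _ NZ] := sN; apply: NZ.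
by apply/quom_projE; rewrite /quom_proj reprK.
Qed.

Fact quom_scaleA a b v : quom_scale a (quom_scale b v) = quom_scale (a * b) v.
Proof. by have [x <-] := quom_proj_surj v; rewrite -!quom_projZ scalerA. Qed.

Fact quom_scale1 : left_id 1 quom_scale.
Proof. by move=> v; have [x <-] := quom_proj_surj v; rewrite -quom_projZ scale1r. Qed.

Fact quom_scaleDr : right_distributive quom_scale +%R.
Proof.
move=> a u v; have [x <-] := quom_proj_surj u; have [y <-] := quom_proj_surj v.
by rewrite -quom_projD -!quom_projZ scalerDr quom_projD.
Qed.

Fact quom_scaleDl v : {morph quom_scale^~ v : a b / a + b}.
Proof.
move=> a b; have [x <-] := quom_proj_surj v.
by rewrite -!quom_projZ scalerDl quom_projD.
Qed.

HB.instance Definition _ := GRing.Zmodule_isLmodule.Build A quom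
  quom_scaleA quom_scale1 quom_scaleDr quom_scaleDl.

Fact quom_pi_linear : linear quom_proj.
Proof. by move=> a x y; rewrite quom_projD quom_projZ. Qed.

Definition quom_pi : {linear M -> quom} := linear_of quom_pi_linear.

Lemma quom_pi_eq0 x : quom_pi x = 0 <-> N x.
Proof. by rewrite -{1}(linear0 quom_pi) -{2}[x]subr0; exact: quom_projE. Qed.

Lemma quom_pi_surj x : exists y, quom_pi y = x.
Proof. exact: quom_proj_surj. Qed.

End Carrier.
End Submodules.

Section ShortExact.
Variable A : pzRingType.
Implicit Types M N K P Q X Y L E C : lmodType A.

Lemma surjP M N (f : {linear M -> N}) :
  Defs.surj f <-> forall y, exists x, f x = y.
Proof.
split=> [fS y|fS]; last by apply/seteqP; split=> // y _; have [x <-] := fS y; exists x.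
have [x _ <-] : range f y by rewrite fS.
by exists x.
Qed.

Lemma exactP M1 M2 M3 (f : {linear M1 -> M2}) (g : {linear M2 -> M3}) :
  exact f g <->
  (forall x, g (f x) = 0) /\ (forall y, g y = 0 -> exists x, f x = y).
Proof.
split=> [fg|[gf fg]].
  split=> [x|y gy]; first by have : ker g (f x) by rewrite -fg; exists x.
  by have : range f y by [rewrite fg]; case=> x _ <-; exists x.
by apply/seteqP; split=> [_ [x _ <-]|y /fg [x <-]]; [exact: gf | exists x].
Qed.

Lemma linear_inj M N (f : {linear M -> N}) :
  (forall x, f x = 0 -> x = 0) -> injective f.
Proof.
move=> f0 x y fxy; apply/eqP; rewrite -subr_eq0; apply/eqP/f0.
by rewrite linearB fxy subrr.
Qed.

(** The factor is [f] after a set-theoretic section of [p]; it is linear because [f] does not see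
    the choice of preimages. *)
Lemma factor_surj M N P (p : {linear P -> M}) (f : {linear P -> N}) :
  (forall y, exists x, p x = y) -> (forall x, p x = 0 -> f x = 0) ->
  exists g : {linear M -> N}, forall x, g (p x) = f x.
Proof.
move=> /choice[s ps] pf.
have gE x : f (s (p x)) = f x.
  by apply/eqP; rewrite -subr_eq0 -linearB pf // linearB ps subrr.
have gL : linear (f \o s).
  move=> a x y; rewrite /= -{1}[x]ps -{1}[y]ps -linearP /= gE linearP //.
by exists (linear_of gL) => x; exact: gE.
Qed.

Lemma factor_inj K P X (i : {linear K -> P}) (f : {linear X -> P}) :
  injective i -> (forall x, exists k, i k = f x) ->
  exists g : {linear X -> K}, forall x, i (g x) = f x.
Proof.
move=> i_inj /choice[g ig].
have gL : linear g by move=> a x y; apply: i_inj; rewrite linearP !ig linearP.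
by exists (linear_of gL).
Qed.

Definition short_exact K P M (i : {linear K -> P}) (p : {linear P -> M}) :=
  [/\ injective i, forall k, p (i k) = 0,
      forall x, p x = 0 -> exists k, i k = x & forall y, exists x, p x = y].

Lemma short_exactP K P M (i : {linear K -> P}) (p : {linear P -> M}) :
  injective i -> exact i p -> Defs.surj p -> short_exact i p.
Proof. by move=> i_inj /exactP[? ?] /surjP. Qed.

Lemma short_exact_ker P M (p : {linear P -> M}) :
  (forall y, exists x, p x = y) ->
  short_exact (subm_incl (submodule_ker p)) p.
Proof.
move=> pS; split=> // [|x].
  exact: subm_inclP.
exact: (subm_incl_surj (submodule_ker p)).
Qed.

Lemma short_exact_quom M (N : set M) (sN : submodule N) :
  short_exact (subm_incl sN) (quom_pi sN).
Proof.
split; first exact: subm_incl_inj.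
- by move=> k; apply/quom_pi_eq0; exact: subm_inclP.
- by move=> x /quom_pi_eq0; exact: subm_incl_surj.
- exact: quom_pi_surj.
Qed.

End ShortExact.

(** * Free and projective modules *)

Section FreeModules.
Variables (A : pzRingType) (T : choiceType).

Definition finite_support : set (T -> A^o) :=
  [set f | exists s : seq T, forall x, x \notin s -> f x = 0]%classic.

Lemma submodule_finite_support : submodule finite_support.
Proof.
split=> [|f g [s fs] [t gt]|a f [s fs]].
- by exists [::].
- exists (s ++ t) => x; rewrite mem_cat negb_or => /andP[xs xt].
  by rewrite -[LHS]/(f x + g x) fs // gt // addr0.
- by exists s => x xs; rewrite -[LHS]/(a *: f x) fs // scaler0.
Qed.

Definition free_module : lmodType A := subm submodule_finite_support.

Implicit Types f g : free_module.

Definition coef f x : A := subm_val f x.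

Arguments coef : simpl never.

Fact free_coord_linear x : linear (fun f => coef f x : A^o).
Proof.
move=> a f g.
exact: (congr1 (@^~ x) (linearP (subm_incl submodule_finite_support) a f g)).
Qed.

Definition free_coord x : {linear free_module -> A^o} :=
  linear_of (free_coord_linear x).

Lemma coefP a f g x : coef (a *: f + g) x = a * coef f x + coef g x.
Proof. exact: free_coord_linear. Qed.

Lemma coef_sum (I : Type) (r : seq I) (P : pred I) (c : I -> A)
    (F : I -> free_module) x :
  coef (\sum_(i <- r | P i) c i *: F i) x =
    \sum_(i <- r | P i) c i * coef (F i) x.
Proof.
rewrite -[LHS]/(free_coord x _) linear_sum.
by apply: eq_bigr => i _; rewrite linearZ.
Qed.

Lemma free_coordP f g : (forall x, coef f x = coef g x) -> f = g.
Proof.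
move=> fg; apply: (@subm_incl_inj _ _ _ submodule_finite_support).
exact: funext.
Qed.

Definition supported f (s : seq T) :=
  uniq s /\ forall x, x \notin s -> coef f x = 0.

Lemma supported_ex f : exists s, supported f s.
Proof.
have [s fs] := subm_inclP f; exists (undup s); split; first exact: undup_uniq.
by move=> x; rewrite mem_undup; exact: fs.
Qed.

Lemma supported_undup f s t : supported f s -> supported f (undup (s ++ t)).
Proof.
case=> _ fs; split; first exact: undup_uniq.
by move=> x; rewrite mem_undup mem_cat negb_or => /andP[/fs].
Qed.

Lemma free_delta_ex x : exists f, forall y, coef f y = (y == x)%:R.
Proof.
have d : finite_support (fun y => (y == x)%:R).
  by exists [:: x] => y; rewrite inE => /negbTE ->.
have [f fE] := subm_incl_surj submodule_finite_support d; exists f => y.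
by rewrite -[RHS]/((fun y => (y == x)%:R : A^o) y) -fE.
Qed.

Lemma free_comb_supp (N : lmodType A) (u : T -> N) f s t :
  supported f s -> supported f t ->
  \sum_(x <- s) coef f x *: u x = \sum_(x <- t) coef f x *: u x.
Proof.
have sub s' t' : supported f s' -> uniq t' -> {subset s' <= t'} ->
    \sum_(x <- s') coef f x *: u x = \sum_(x <- t') coef f x *: u x.
  case=> us fs ut st; rewrite [RHS](bigID (mem s')) /= [X in _ + X]big1 ?addr0.
    rewrite -[RHS]big_filter; apply: perm_big; apply: uniq_perm => //.
      exact: filter_uniq.
    by move=> x; rewrite mem_filter /=; case: (boolP (x \in s')) => // /st.
  by move=> x /fs ->; rewrite scale0r.
move=> fs ft; rewrite (sub s (undup (s ++ t))) ?(sub t (undup (s ++ t))) ?undup_uniq //;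
  by move=> x xs; rewrite mem_undup mem_cat xs ?orbT.
Qed.

Lemma free_lift (N : lmodType A) (u : T -> N) :
  exists e : {linear free_module -> N}, forall f s, supported f s ->
    e f = \sum_(x <- s) coef f x *: u x.
Proof.
have [s fs] := choice supported_ex.
pose e f := \sum_(x <- s f) coef f x *: u x.
have eE f t : supported f t -> e f = \sum_(x <- t) coef f x *: u x.
  by move=> ft; apply: free_comb_supp.
suff eL : linear e by exists (linear_of eL).
move=> a f g; pose t := undup (s f ++ s g).
have ft : supported f t by exact: supported_undup.
have gt : supported g t.
  split; first exact: undup_uniq.
  by move=> x; rewrite mem_undup mem_cat negb_or => /andP[_]; apply: (fs g).2.
have fgt : supported (a *: f + g) t.
  split; first exact: undup_uniq.
  by move=> x xt; rewrite coefP (ft.2 _ xt) (gt.2 _ xt) mulr0 addr0.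
rewrite (eE _ _ ft) (eE _ _ gt) (eE _ _ fgt) scaler_sumr -big_split /=.
by apply: eq_bigr => x _; rewrite coefP scalerDl scalerA.
Qed.

Lemma projective_free : projective free_module.
Proof.
move=> M N g f /surjP gS; have [d dE] := choice free_delta_ex.
have [u uE] := choice (fun x => gS (f (d x))).
have [h hE] := free_lift u; exists h => c.
have [s cs] := supported_ex c; rewrite (hE _ _ cs) linear_sum /=.
have -> : f c = f (\sum_(x <- s) coef c x *: d x).
  congr (f _); apply: free_coordP => y; rewrite coef_sum.
  have [us c0] := cs; case: (boolP (y \in s)) => [ys|ys].
    rewrite (bigD1_seq y) //= dE eqxx mulr1 big1 ?addr0 // => x xy.
    by rewrite dE eq_sym (negbTE xy) mulr0.
  rewrite c0 // big_seq big1 // => x xs; rewrite dE.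
  by case: eqP => [yx|_]; [rewrite yx xs in ys | rewrite mulr0].
by rewrite linear_sum; apply: eq_bigr => x _; rewrite !linearZ /= uE.
Qed.

Lemma free_lift_delta (N : lmodType A) (u : T -> N) (e : {linear free_module -> N}) :
  (forall f s, supported f s -> e f = \sum_(x <- s) coef f x *: u x) ->
  forall x, exists f, e f = u x.
Proof.
move=> eE x; have [d dE] := free_delta_ex x; exists d.
rewrite (eE _ [:: x]) ?big_seq1 ?dE ?eqxx ?scale1r //.
by split=> // y; rewrite inE dE => /negbTE ->.
Qed.

End FreeModules.

Section Projectives.
Variable A : pzRingType.
Implicit Types M N K P Q X Y L E C : lmodType A.

Lemma enough_projectives M : exists (P : lmodType A) (p : {linear P -> M}),
  projective P /\ forall y, exists x, p x = y.
Proof.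
have [e eE] := free_lift (A := A) (fun x : M => x).
exists (free_module A M), e; split; first exact: projective_free.
exact: free_lift_delta eE.
Qed.

Lemma fin_genP M : fin_gen M <->
  exists n (g : 'I_n -> M), forall x, exists c : 'I_n -> A, x = \sum_i c i *: g i.
Proof.
split=> -[n [g Mg]]; exists n, g; last first.
  by apply/seteqP; split=> // x _; exact: Mg.
by move=> x; suff : [set: M]%classic x by rewrite Mg.
Qed.

Lemma fin_gen_cover M : fin_gen M -> exists n (e : {linear free_module A 'I_n -> M}),
  forall y, exists x, e x = y.
Proof.
move=> /fin_genP[n [g Mg]]; have [e eE] := free_lift (A := A) g.
exists n, e => y; have [c ->] := Mg y.
have [d dE] := choice (free_lift_delta eE).
exists (\sum_i c i *: d i); rewrite linear_sum; apply: eq_bigr => i _.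
by rewrite linearZ /= dE.
Qed.

Lemma free_fin_gen n : fin_gen (free_module A 'I_n).
Proof.
have [d dE] := choice (@free_delta_ex A 'I_n).
apply/fin_genP; exists n, d => f; exists (coef f).
apply: free_coordP => j; rewrite coef_sum (bigD1 j) //= big1.
  by rewrite dE eqxx mulr1 addr0.
by move=> i ij; rewrite dE eq_sym (negbTE ij) mulr0.
Qed.

(** The cover [e] by the free module on the generators has a section [h], and the functionals are
    the coordinates of [h]. *)
Lemma dual_basis P : projective P -> fin_gen P ->
  exists n (phi : 'I_n -> {linear P -> A^o}) (g : 'I_n -> P),
    forall x, x = \sum_i (phi i x : A) *: g i.
Proof.
move=> projP /fin_genP[n [g Pg]]; have [e eE] := free_lift (A := A) g.
have eS y : exists x, e x = y.
  have [c ->] := Pg y; have [d dE] := choice (free_lift_delta eE).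
  exists (\sum_i c i *: d i); rewrite linear_sum; apply: eq_bigr => i _.
  by rewrite linearZ /= dE.
have [h hE] := projP _ _ e idfun (proj2 (surjP e) eS).
exists n, (fun i => free_coord A i \o h), g => x.
rewrite -{1}[x]/(idfun x) -(hE x) (eE _ (enum 'I_n)) ?big_enum //.
by split=> [|i]; rewrite ?enum_uniq ?mem_enum.
Qed.

Lemma fin_gen_image M N (f : {linear M -> N}) :
  fin_gen M -> (forall y, exists x, f x = y) -> fin_gen N.
Proof.
move=> /fin_genP[n [g Mg]] fS; apply/fin_genP; exists n, (f \o g) => y.
have [x <-] := fS y; have [c ->] := Mg x; exists c.
by rewrite linear_sum; apply: eq_bigr => i _; rewrite linearZ.
Qed.

End Projectives.

(** * Baer's criterion *)

Lemma Zorn_submodule (A : pzRingType) (M : lmodType A) (B : set M)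
    (good : set M -> Prop) :
  submodule B -> good B ->
  (forall F : set (set M), total_on F subset -> (exists G, F G) ->
     (forall G, F G -> submodule G /\ good G) ->
     good (\bigcup_(G in F) G)%classic) ->
  exists G : set M, [/\ submodule G, good G, (B `<=` G)%classic
    & forall H : set M, submodule H -> good H -> (G `<=` H)%classic -> H = G].
Proof.
move=> sB gB chain.
pose P (G : set M) := G = set0 \/ [/\ submodule G, good G & (B `<=` G)%classic].
have B0 : B 0 by case: sB.
have [F FP Ftot|G [PG maxG]] := @Zorn_bigcup M P.
  have [[G0 [FG0 G0n]]|nF] := EM (exists G, F G /\ G !=set0)%classic; last first.
    left; apply/seteqP; split=> // x [G FG Gx]; exfalso.
    by apply: nF; exists G; split=> //; exists x.
  right; pose F' : set (set M) := [set G | F G /\ G !=set0]%classic.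
  have F'P G : F' G -> [/\ submodule G, good G & (B `<=` G)%classic].
    by case=> /FP[->|//] /set0P; rewrite eqxx.
  have -> : (\bigcup_(G in F) G = \bigcup_(G in F') G)%classic.
    apply/seteqP; split=> x [G].
      by move=> FG Gx; exists G => //; split=> //; exists x.
    by case=> FG _ Gx; exists G.
  have F'tot : total_on F' subset by move=> X Y [FX _] [FY _]; exact: Ftot.
  have F'0 : F' G0 by [].
  split; last by move=> x Bx; exists G0 => //; have [_ _] := F'P _ F'0; apply.
    split.
    - by exists G0 => //; have [[]] := F'P _ F'0.
    - move=> x y [X F'X Xx] [Y F'Y Yy].
      have [XY|YX] := F'tot _ _ F'X F'Y.
        by exists Y => //; have [[_ YD _] _ _] := F'P _ F'Y; apply: YD => //; exact: XY.
      by exists X => //; have [[_ XD _] _ _] := F'P _ F'X; apply: XD => //; exact: YX.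
    - move=> a x [X F'X Xx]; exists X => //.
      by have [[_ _ XZ] _ _] := F'P _ F'X; exact: XZ.
  apply: chain => //; first by exists G0.
  by move=> G /F'P[].
case: PG => [G0|[sG gG BG]].
  exfalso; apply: (maxG B); last by right; split.
  by rewrite G0; split=> // /(_ _ B0).
exists G; split=> // H sH gH GH; apply: contrapT => HG.
apply: (maxG H); last by right; split=> // x /BG /GH.
by split=> // HG'; apply: HG; apply/seteqP; split.
Qed.

(** Zorn's lemma is applied to graphs of partial extensions: submodules of [N * E] that contain the
    graph of [f] along [i] and are single-valued, which need only be asked at 0. A map on an ideal
    is given as a total function constrained on the ideal only. *)
Lemma baer_criterion (A : pzRingType) (E : lmodType A) :
  (forall (I : set A^o) (f : A -> E), submodule I ->
     (forall a b : A, I a -> I b -> f (a + b) = f a + f b) ->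
     (forall c a : A, I a -> f (c * a) = c *: f a) ->
     exists e, forall a : A, I a -> f a = a *: e) ->
  injective_module E.
Proof.
move=> baer M N i f i_inj.
pose good (G : set (N * E)%type) := forall e, G (0, e) -> e = 0.
pose B : set (N * E)%type := [set x | exists m, x = (i m, f m)]%classic.
have sB : submodule B.
  split=> [|_ _ [x ->] [y ->]|a _ [x ->]].
  - by exists 0; rewrite !linear0.
  - by exists (x + y); rewrite !linearD.
  - by exists (a *: x); rewrite !linearZ.
have gB : good B.
  move=> e [m [i0 ->]]; rewrite (_ : m = 0) ?linear0 //.
  by apply: i_inj; rewrite linear0.
have [|G [sG gG BG maxG]] := Zorn_submodule sB gB.
  by move=> F _ _ FP e [G /FP[_ gG] /gG].
have [G0 GD GZ] := sG.
have Gfun a x y : G (a, x) -> G (a, y) -> x = y.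
  move=> Gx Gy; apply/eqP; rewrite -subr_eq0; apply/eqP/gG.
  by rewrite -(subrr a); exact: (submoduleB sG Gx Gy).
have dom n : exists e, G (n, e).
  (* The ideal of scalars that move [n] into the domain of the maximal graph. *)
  pose I : set A^o := [set a : A^o | exists e, G ((a : A) *: n, e)]%classic.
  have sI : submodule I.
    split; first by exists 0; rewrite scale0r.
      move=> a b [x Gx] [y Gy]; exists (x + y); rewrite scalerDl.
      exact: (GD _ _ Gx Gy).
    by move=> c a [x Gx]; exists (c *: x); rewrite -scalerA; exact: (GZ c _ Gx).
  have /choice[g gE] : forall a : A, exists e, I a -> G (a *: n, e).
    by move=> a; have [[e Ge]|nI] := EM (I a); [exists e | exists 0].
  have [||e0 e0E] := baer I g sI.
  - move=> a b Ia Ib; apply: (Gfun ((a + b) *: n)).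
      by apply: gE; case: sI => _ ID _; exact: ID.
    by rewrite scalerDl; exact: (GD _ _ (gE _ Ia) (gE _ Ib)).
  - move=> c a Ia; apply: (Gfun ((c * a) *: n)).
      by apply: gE; case: sI => _ _ IZ; exact: IZ.
    by rewrite -scalerA; exact: (GZ c _ (gE _ Ia)).
  (* The graph enlarged by sending [n] to [e0]; it stays single-valued by the choice of [e0]. *)
  pose H : set (N * E)%type :=
    [set z | exists x a, G x /\ z = x + a *: (n, e0)]%classic.
  suff HG : H = G by exists e0; rewrite -HG; exists 0, 1; rewrite add0r scale1r.
  apply: maxG; last by move=> x Gx; exists x, 0; rewrite scale0r addr0.
    split; first by exists 0, 0; rewrite scale0r addr0.
      move=> _ _ [x [a [Gx ->]]] [y [b [Gy ->]]]; exists (x + y), (a + b).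
      by rewrite scalerDl addrACA; split=> //; exact: GD.
    move=> c _ [x [a [Gx ->]]]; exists (c *: x), (c * a).
    by rewrite scalerDr scalerA; split=> //; exact: GZ.
  move=> e [[m x] [a [Gx [/esym mE ->]]]].
  have Ia : I a.
    exists (- x); have := submoduleN sG Gx; congr (G (_, _)).
    by apply/esym/eqP; rewrite -addr_eq0 addrC; exact/eqP.
  apply: gG; rewrite -[0]mE -(e0E _ Ia).
  exact: (GD _ _ Gx (gE _ Ia)).
have [h hE] := choice dom.
have hL : linear h.
  by move=> a x y; apply: Gfun (hE _) _; exact: (GD _ _ (GZ a _ (hE x)) (hE y)).
by exists (linear_of hL) => x; apply: Gfun (hE _) _; apply: BG; exists x.
Qed.

(** * The injective abelian group Q/Z *)

Lemma int_ideal_principal (I : set int^o) :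
  submodule I -> exists k : int, forall n : int, I n <-> exists m : int, n = m * k.
Proof.
move=> sI; have [I0 ID IZ] := sI.
have [exk|nk] := EM (exists k, (0 < k)%N /\ I k%:Z); last first.
  exists 0 => n; split=> [In|[m ->]]; last by rewrite mulr0.
  exists 0; rewrite mul0r; apply: contrapT => n0; apply: nk.
  exists `|n|%N; rewrite absz_gt0; split; first exact/eqP.
  by rewrite abszE; case: ger0P => // _; exact: (submoduleN sI In).
have exk' : exists k, (0 < k)%N && `[< I k%:Z >].
  by have [k [k0 Ik]] := exk; exists k; rewrite k0; apply/asboolP.
case: (ex_minnP exk') => k /andP[k0 /asboolP Ik] mink; exists k => n.
split=> [In|[m ->]]; last exact: (IZ m).
exists (n %/ k)%Z; rewrite {1}(divz_eq n k).
suff -> : (n %% k)%Z = 0 by rewrite addr0.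
have k00 : k%:Z != 0 by rewrite -lt0n.
have mod_ge0 := modz_ge0 n k00.
have Imod : I (n %% k)%Z.
  rewrite (_ : (n %% k)%Z = n - (n %/ k)%Z * k).
    exact: (submoduleB sI In (IZ (n %/ k)%Z _ Ik)).
  by rewrite {2}(divz_eq n k) addrC addKr.
apply/eqP; rewrite -absz_eq0 -leqn0 leqNgt; apply/negP => m0.
have := mink `|(n %% k)%Z|%N; rewrite m0 (gez0_abs mod_ge0) /=.
have /asboolP -> := Imod => /(_ isT); rewrite leqNgt => /negP; apply.
by rewrite -ltz_nat (gez0_abs mod_ge0) ltz_mod.
Qed.

Definition is_integer : set (zmodule rat) :=
  [set q : rat | exists n : int, q = n%:~R]%classic.

Lemma submodule_is_integer : submodule (is_integer : set (zmodule rat : lmodType int)).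
Proof.
split; first by exists 0.
  by move=> _ _ [m ->] [n ->]; exists (m + n); rewrite rmorphD.
by move=> a _ [m ->]; exists (m * a); rewrite scalezrE mulrzA.
Qed.

Definition QmodZ : lmodType int := quom submodule_is_integer.

Definition QmodZ_of : {linear (zmodule rat : lmodType int) -> QmodZ} :=
  quom_pi submodule_is_integer.

Lemma QmodZ_ofM (m : int) (q : rat) : QmodZ_of (m%:~R * q) = m *: QmodZ_of q.
Proof. by rewrite -linearZ scalezrE mulrzl. Qed.

(** By Baer's criterion and principality of the ideals of the integers, this is divisibility: a
    representative of [f k] is divided by [k]. *)
Lemma injective_QmodZ : injective_module QmodZ.
Proof.
apply: baer_criterion => I f sI fD fZ.
have [k IE] := int_ideal_principal sI.
have Ik : I k by apply/IE; exists 1; rewrite mul1r.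
have [k0|k0] := eqVneq k 0.
  exists 0 => _ /IE[m ->]; rewrite k0 mulr0 scaler0.
  by rewrite -(mul0r k) fZ // scale0r.
have [q qE] := quom_pi_surj (f k).
exists (QmodZ_of (q / k%:~R)) => _ /IE[m ->].
rewrite fZ // -qE -[quom_pi _ q]/(QmodZ_of q) -!QmodZ_ofM.
congr (QmodZ_of _); rewrite intrM -mulrA; congr (_ * _).
by rewrite mulrC mulfVK // intr_eq0.
Qed.

Section Characters.
Implicit Types M N : zmodType.

(** Additivity alone is asked, so that an A-module need not be given a second module structure over
    the integers; linearity over them follows. *)
Definition character M : set (M -> QmodZ) :=
  [set f | forall x y, f (x + y) = f x + f y]%classic.

Lemma character_linear M (f : M -> QmodZ) : character f ->
  linear (f : (zmodule M : lmodType int) -> QmodZ).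
Proof.
move=> fD a x y; rewrite fD; congr (_ + _).
have f0 : f 0 = 0 by apply: (addrI (f 0)); rewrite -fD !addr0.
have fN z : f (- z) = - f z by apply/eqP; rewrite -addr_eq0 -fD addNr f0.
have fn n z : f (z *+ n) = n%:Z *: f z.
  elim: n => [|n IHn]; first by rewrite mulr0n scale0r.
  by rewrite mulrSr fD IHn -addn1 PoszD scalerDl scale1r.
rewrite scalezrE; case: a => n; first exact: fn.
by rewrite NegzE mulrNz fN fn scaleNr.
Qed.

Lemma character_extend M N (i : M -> N) (f : M -> QmodZ) :
  injective i -> (forall x y, i (x + y) = i x + i y) -> character f ->
  exists2 g : N -> QmodZ, character g & forall x, g (i x) = f x.
Proof.
move=> i_inj iD fD.
have i0 : i 0 = 0 by apply: (addrI (i 0)); rewrite -iD !addr0.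
have iN z : i (- z) = - i z by apply/eqP; rewrite -addr_eq0 -iD addNr i0.
have iL : linear (i : (zmodule M : lmodType int) -> (zmodule N : lmodType int)).
  move=> a x y; rewrite iD; congr (_ + _).
  have ixn n z : i (z *+ n) = i z *+ n.
    by elim: n => [|n IHn]; rewrite ?mulr0n // !mulrSr iD IHn.
  rewrite !scalezrE; case: a => n; first exact: ixn.
  by rewrite NegzE !mulrNz iN ixn.
have [g gE] := injective_QmodZ (i := linear_of iL)
  (linear_of (character_linear fD)) i_inj.
by exists g => // x y; rewrite linearD.
Qed.

Lemma character_separates M (x : M) : x != 0 ->
  exists2 f : M -> QmodZ, character f & f x != 0.
Proof.
move=> x0; pose I : set int^o := [set n : int | x *~ n = 0]%classic.
have sI : submodule I.
  split=> [|a b|a b]; rewrite /I /= ?mulr0z //.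
    by move=> xa xb; rewrite mulrzDr xa xb addr0.
  by move=> xb; rewrite /GRing.scale /= mulrC mulrzA xb mul0rz.
have [k IE] := int_ideal_principal sI.
pose q : rat := if k == 0 then 2^-1 else k%:~R^-1.
have q_notint n : q = n%:~R -> False.
  rewrite /q; case: eqP => [_|/eqP k0] qn.
    have : (2 * n)%:~R = 1%:~R :> rat by rewrite intrM -qn mulfV.
    by move/intr_inj; lia.
  have : (k * n)%:~R = 1%:~R :> rat by rewrite intrM -qn mulfV // intr_eq0.
  move/intr_inj => kn; have : I 1 by apply/IE; exists n; rewrite mulrC.
  by rewrite /I /= mulr1z; exact/eqP.
pose S : set (zmodule M) := [set y : M | exists n : int, y = x *~ n]%classic.
have sS : submodule (S : set (zmodule M : lmodType int)).
  split; first by exists 0; rewrite mulr0z.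
    by move=> _ _ [m ->] [n ->]; exists (m + n); rewrite mulrzDr.
  by move=> a _ [n ->]; exists (n * a); rewrite scalezrE mulrzA.
have mx : linear (fun n : int^o => x *~ n : (zmodule M : lmodType int)).
  by move=> a m n; rewrite mulrzDr scalezrE -mulrzA [m * a]mulrC.
have mxS n : S (linear_of mx n) by exists n.
have [p pE] := factor_inj (f := linear_of mx) (subm_incl_inj (sN := sS))
  (fun n => subm_incl_surj sS (mxS n)).
have pS y : exists n, p n = y.
  have [n yn] := subm_inclP y; exists n; apply: (@subm_incl_inj _ _ _ sS).
  by rewrite pE.
have mq : linear (fun n : int^o => QmodZ_of (n%:~R * q)).
  by move=> a m n; rewrite !QmodZ_ofM scalerDl scalerA.
have [n pn|g gE] := factor_surj (f := linear_of mq) pS.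
  have : I n by have := pE n; rewrite pn linear0 => /esym.
  case/IE=> m ->; rewrite -[LHS]/(QmodZ_of _) /q intrM.
  case: eqP => [->|/eqP k0]; first by rewrite mulr0 mul0r linear0.
  by rewrite mulfK ?intr_eq0 //; apply/quom_pi_eq0; exists m.
have [h hE] := injective_QmodZ g (subm_incl_inj (sN := sS)).
exists h; first by move=> y z; rewrite (linearD h).
have -> : x = subm_incl sS (p 1) by rewrite pE.
rewrite hE gE /= mul1r; apply/eqP => /quom_pi_eq0[n]; exact: q_notint.
Qed.

End Characters.

(** * Character duals *)

Lemma submodule_character (M : zmodType) :
  submodule (@character M : set (M -> QmodZ)).
Proof.
split=> [x y|f g fD gD x y|a f fD x y].
- by rewrite -[RHS]/(0 + 0 : QmodZ) addr0.
- by rewrite -![(f + g) _]/(f _ + g _) fD gD addrACA.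
- by rewrite -![(a *: f) _]/(a *: f _) fD scalerDr.
Qed.

(** With duals parametrized by an anti-morphism, one construction serves both directions between
    left and right modules, and [A^c^c] never has to be identified with [A]. *)
Record anti_morphism (A B : pzRingType) := AntiMorphism {
  anti :> B -> A;
  antiD : forall x y, anti (x + y) = anti x + anti y;
  antiM : forall x y, anti (x * y) = anti y * anti x;
  anti1 : anti 1 = 1
}.

Section Dual.
Variables (A B : pzRingType) (t : anti_morphism A B) (M : lmodType A).

(** The type is tagged by the anti-morphism because the action of [B] depends on it. *)
Definition dual_of of anti_morphism A B : Type := subm (submodule_character M).
Local Notation D := (dual_of t).

HB.instance Definition _ := GRing.Zmodule.on D.

Definition dual_app (f : D) : M -> QmodZ := subm_val f.

Lemma dual_appD f x y : dual_app f (x + y) = dual_app f x + dual_app f y.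
Proof. exact: (subm_inclP f). Qed.

Lemma dual_app0 f : dual_app f 0 = 0.
Proof. by apply: (addrI (dual_app f 0)); rewrite -dual_appD !addr0. Qed.

Lemma dual_appB f x y : dual_app f (x - y) = dual_app f x - dual_app f y.
Proof.
apply/eqP; rewrite -subr_eq opprK -dual_appD addrNK //.
Qed.

Lemma dualP f g : (forall x, dual_app f x = dual_app g x) -> f = g.
Proof.
move=> fg; apply: (@subm_incl_inj _ _ _ (submodule_character M)).
exact: funext.
Qed.

Lemma dual_mk (f : M -> QmodZ) : character f ->
  exists g : D, forall x, dual_app g x = f x.
Proof.
by move=> /(subm_incl_surj (submodule_character M))[g gE]; exists g => x; rewrite -gE.
Qed.

Lemma dual_add_app (f g : D) x :
  dual_app (f + g) x = dual_app f x + dual_app g x.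
Proof. by []. Qed.

Fact dual_scale_subproof (b : B) (f : D) :
  character (fun x => dual_app f (t b *: x)).
Proof. by move=> x y; rewrite scalerDr dual_appD. Qed.

Definition dual_scale (b : B) (f : D) : D :=
  sval (cid (dual_mk (dual_scale_subproof b f))).

Lemma dual_scaleE b f x : dual_app (dual_scale b f) x = dual_app f (t b *: x).
Proof. by rewrite /dual_scale; case: cid. Qed.

Fact dual_scaleA a b f : dual_scale a (dual_scale b f) = dual_scale (a * b) f.
Proof. by apply: dualP => x; rewrite !dual_scaleE antiM scalerA. Qed.

Fact dual_scale1 : left_id 1 dual_scale.
Proof. by move=> f; apply: dualP => x; rewrite dual_scaleE anti1 scale1r. Qed.

Fact dual_scaleDr : right_distributive dual_scale +%R.
Proof.
by move=> a f g; apply: dualP => x; rewrite dual_scaleE !dual_add_app !dual_scaleE.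
Qed.

Fact dual_scaleDl f : {morph dual_scale^~ f : a b / a + b}.
Proof.
move=> a b; apply: dualP => x.
by rewrite dual_add_app !dual_scaleE antiD scalerDl dual_appD.
Qed.

HB.instance Definition _ := GRing.Zmodule_isLmodule.Build B D
  dual_scaleA dual_scale1 dual_scaleDr dual_scaleDl.

Definition dual : lmodType B := dual_of t.

Lemma dual_lin_app (a : B) (f g : dual) x :
  dual_app (a *: f + g) x = dual_app f (t a *: x) + dual_app g x.
Proof. by rewrite dual_add_app dual_scaleE. Qed.

Lemma dual_scale_app (a : B) (f : dual) x :
  dual_app (a *: f) x = dual_app f (t a *: x).
Proof. exact: dual_scaleE. Qed.

End Dual.

Section DualMaps.
Variables (A B : pzRingType) (t : anti_morphism A B).
Implicit Types M N K P : lmodType A.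

Lemma dual_map_ex M N (f : {linear M -> N}) :
  exists g : {linear dual t N -> dual t M},
    forall c x, dual_app (g c) x = dual_app c (f x).
Proof.
have /choice[g gE] : forall c : dual t N, exists d : dual t M,
    forall x, dual_app d x = dual_app c (f x).
  by move=> c; apply: dual_mk => x y; rewrite linearD dual_appD.
suff gL : linear g by exists (linear_of gL).
move=> a c d; apply: dualP => x.
by rewrite gE !dual_lin_app !gE linearZ.
Qed.

Lemma dual_surj M N (f : {linear M -> N}) (g : {linear dual t N -> dual t M}) :
  injective f -> (forall c x, dual_app (g c) x = dual_app c (f x)) ->
  forall c, exists d, g d = c.
Proof.
move=> f_inj gE c.
have [d dD dE] := character_extend f_inj (linearD f) (@dual_appD _ _ t _ c).
have [d' d'E] := dual_mk t dD.
by exists d'; apply: dualP => x; rewrite gE d'E dE.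
Qed.

Lemma dual_short_exact K P M (i : {linear K -> P}) (p : {linear P -> M})
    (i' : {linear dual t P -> dual t K}) (p' : {linear dual t M -> dual t P}) :
  (forall c x, dual_app (i' c) x = dual_app c (i x)) ->
  (forall c x, dual_app (p' c) x = dual_app c (p x)) ->
  short_exact i p -> short_exact p' i'.
Proof.
move=> iE pE [i_inj pi ker_p pS]; split.
- move=> c d cd; apply: dualP => y; have [x <-] := pS y.
  by rewrite -!pE cd.
- by move=> c; apply: dualP => x; rewrite iE pE pi dual_app0.
- move=> c ic; have [s sE] := choice pS.
  have c0 x y : p x = p y -> dual_app c x = dual_app c y.
    move=> pxy; apply/eqP; rewrite -subr_eq0 -dual_appB.
    have [|k <-] := ker_p (x - y); first by rewrite linearB pxy subrr.
    by rewrite -iE ic.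
  have [|d dE] := @dual_mk _ _ t _ (fun y => dual_app c (s y)).
    by move=> x y; rewrite -dual_appD; apply: c0; rewrite linearD !sE.
  by exists d; apply: dualP => x; rewrite pE dE; apply: c0; rewrite sE.
- exact: dual_surj iE.
Qed.

Lemma dual_separates M (x : M) : x != 0 -> exists c : dual t M, dual_app c x != 0.
Proof.
move=> /character_separates[f fD fx]; have [c cE] := dual_mk t fD.
by exists c; rewrite cE.
Qed.

End DualMaps.

(** Maps from [M] to the dual of [P] and maps from [P] to the dual of [M] are the same balanced
    pairings with values in Q/Z. *)
Lemma dual_transpose (A B : pzRingType) (t : anti_morphism A B)
    (s : anti_morphism B A) (P : lmodType A) (M : lmodType B)
    (f : {linear M -> dual t P}) :
  (forall a, t (s a) = a) ->
  exists g : {linear P -> dual s M},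
    forall x m, dual_app (g x) m = dual_app (f m) x.
Proof.
move=> ts; have /choice[g gE] : forall x : P, exists c : dual s M,
    forall m, dual_app c m = dual_app (f m) x.
  by move=> x; apply: dual_mk => m n; rewrite linearD.
suff gL : linear g by exists (linear_of gL).
move=> a x y; apply: dualP => m.
by rewrite dual_lin_app !gE linearZ dual_scale_app ts dual_appD.
Qed.

(** Transposition turns extending along [i] into lifting along the dual of [i], which is onto
    because Q/Z is injective. *)
Lemma injective_dual (A B : pzRingType) (t : anti_morphism A B)
    (s : anti_morphism B A) (P : lmodType A) :
  (forall a, t (s a) = a) -> (forall b, s (t b) = b) ->
  projective P -> injective_module (dual t P).
Proof.
move=> ts st projP M N i f i_inj.
have [i' i'E] := dual_map_ex s i.
have [g gE] := dual_transpose f ts.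
have [h hE] := projP _ _ i' g (proj2 (surjP i') (dual_surj i_inj i'E)).
have [h' h'E] := dual_transpose h st.
by exists h' => m; apply: dualP => x; rewrite h'E -i'E hE gE.
Qed.

Section Converse.
Variable A : pzRingType.

Definition to_converse : anti_morphism A A^c :=
  @AntiMorphism A A^c (fun x => x) (fun _ _ => erefl) (fun _ _ => erefl) erefl.

Definition of_converse : anti_morphism A^c A :=
  @AntiMorphism A^c A (fun x => x) (fun _ _ => erefl) (fun _ _ => erefl) erefl.

(** A projective cover-all [P] of the dual of [M] gives by transposition a map from [M] to the dual
    of [P]; it is injective as characters separate points. *)
Lemma enough_injectives (M : lmodType A) :
  exists (E : lmodType A) (i : {linear M -> E}), injective_module E /\ injective i.
Proof.
have [P [p [projP pS]]] := enough_projectives (dual to_converse M).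
have [g gE] := @dual_transpose _ _ _ of_converse _ _ p (fun=> erefl).
exists (dual of_converse P), g; split.
  exact: (@injective_dual _ _ of_converse to_converse _ (fun=> erefl)
    (fun=> erefl) projP).
apply: linear_inj => x gx; apply/eqP/negP => /negP.
move=> /(dual_separates to_converse)[c]; have [y <-] := pS c.
by rewrite -gE gx eqxx.
Qed.

End Converse.

(** * Vanishing of Ext and homological dimensions *)

Section ExtVanishing.
Variable A : pzRingType.
Implicit Types M N K P Q X Y L E C : lmodType A.

(** Vanishing of Ext^1(M, N), stated over all short exact sequences ending in [M], with arbitrary
    middle term; by [ext1_zero_proj] one with projective middle term suffices. *)
Definition ext1_zero M N := forall K P (i : {linear K -> P}) (p : {linear P -> M}),
  short_exact i p -> forall f : {linear K -> N},
    exists g : {linear P -> N}, forall k, g (i k) = f k.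

(* [ext_zero n M N] expresses that Ext^(n+1)(M, N) = 0. *)
Fixpoint ext_zero (n : nat) M N : Prop :=
  if n is m.+1 then
    forall K P (i : {linear K -> P}) (p : {linear P -> M}),
      short_exact i p -> projective P -> ext_zero m K N
  else ext1_zero M N.

(** A form of [proj_resolution_le] that takes one syzygy at a time, suited to dimension shifting;
    [idim_le] is its counterpart for cosyzygies. *)
Fixpoint pdim_le (n : nat) M : Prop :=
  if n is m.+1 then
    exists K P (i : {linear K -> P}) (p : {linear P -> M}),
      [/\ short_exact i p, projective P & pdim_le m K]
  else projective M.

Fixpoint idim_le (n : nat) N : Prop :=
  if n is m.+1 then
    exists E C (j : {linear N -> E}) (q : {linear E -> C}),
      [/\ short_exact j q, injective_module E & idim_le m C]
  else injective_module N.

Lemma projective_presentation M : exists K P (i : {linear K -> P}) (p : {linear P -> M}),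
  short_exact i p /\ projective P.
Proof.
have [P [p [projP pS]]] := enough_projectives M.
exists (subm (submodule_ker p)), P, (subm_incl _), p; split=> //.
exact: short_exact_ker.
Qed.

Lemma injective_copresentation N : exists E C (j : {linear N -> E}) (q : {linear E -> C}),
  short_exact j q /\ injective_module E.
Proof.
have [E [j [injE j_inj]]] := enough_injectives N.
have sR : submodule (range j) by apply: submodule_image; split.
exists E, (quom sR), j, (quom_pi sR); split=> //; split=> //.
- by move=> k; apply/quom_pi_eq0; exists k.
- by move=> x /quom_pi_eq0[k _ <-]; exists k.
- exact: quom_pi_surj.
Qed.

(** Any other sequence is a pushout of the projective one: [P'] is a quotient of [K' * P] through
    [i'] and the comparison map [u]. Hence [f'] on [K'] and an extension [g] on [P] glue to a map on
    [P']. *)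
Lemma ext1_zero_proj M N K P (i : {linear K -> P}) (p : {linear P -> M}) :
  short_exact i p -> projective P ->
  (forall f : {linear K -> N}, exists g : {linear P -> N}, forall k, g (i k) = f k) ->
  ext1_zero M N.
Proof.
move=> [i_inj pi ker_p pS] projP ext K' P' i' p' [i'_inj p'i' ker_p' p'S] f'.
have [u uE] := projP _ _ p' p (proj2 (surjP p') p'S).
have [|v vE] := factor_inj (f := u \o i) i'_inj.
  by move=> k; apply: ker_p'; rewrite /= uE pi.
have [g gE] := ext (f' \o v).
have sumL (X : lmodType A) (b : {linear K' -> X}) (c : {linear P -> X}) :
    linear (fun z : (K' * P)%type => b z.1 + c z.2).
  by move=> a x y; rewrite !linearP scalerDr addrACA.
have [y|z|h hE] := factor_surj (p := linear_of (sumL _ i' u))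
  (f := linear_of (sumL _ f' g)); last first.
- by exists h => k; have := hE (k, 0); rewrite /= !linear0 !addr0.
- move=> /= z0; have [|k kE] := ker_p z.2.
    by rewrite -uE; have := congr1 p' z0; rewrite linearD p'i' add0r linear0.
  have : i' (z.1 + v k) = 0 by rewrite linearD vE /= kE.
  rewrite -(linear0 i') => /i'_inj /eqP; rewrite addr_eq0 => /eqP ->.
  by rewrite -kE gE linearN /= addNr.
- have [x xE] := pS (p' y); have [|k kE] := ker_p' (y - u x).
    by rewrite linearB uE xE subrr.
  by exists (k, x); rewrite /= kE subrK.
Qed.

(** The exact sequence Hom(M, E) -> Hom(M, C) -> Ext^1(M, N): a lift [u] on a projective cover of
    [M] is corrected by an extension of its restriction to the kernel. *)
Lemma ext1_zero_lift M N E C (j : {linear N -> E}) (q : {linear E -> C}) :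
  ext1_zero M N -> short_exact j q ->
  forall f : {linear M -> C}, exists h : {linear M -> E}, forall x, q (h x) = f x.
Proof.
move=> ext [j_inj qj ker_q qS] f.
have [K [P [i [p [ip projP]]]]] := projective_presentation M.
have [i_inj pi ker_p pS] := ip.
have [u uE] := projP _ _ q (f \o p) (proj2 (surjP q) qS).
have [|v vE] := factor_inj (f := u \o i) j_inj.
  by move=> k; apply: ker_q; rewrite /= uE /= pi linear0.
have [g gE] := ext _ _ _ _ ip v.
have [|h hE] := factor_surj (f := u \- (j \o g)) pS.
  by move=> x /ker_p[k <-]; rewrite /= gE vE subrr.
exists h => x; have [y <-] := pS x.
by rewrite hE linearB qj subr0 uE.
Qed.

Lemma ext1_zero_of_lift M N E C (j : {linear N -> E}) (q : {linear E -> C}) :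
  short_exact j q -> injective_module E ->
  (forall f : {linear M -> C}, exists h : {linear M -> E}, forall x, q (h x) = f x) ->
  ext1_zero M N.
Proof.
move=> [j_inj qj ker_q qS] injE lift K P i p [i_inj pi ker_p pS] f.
have [u uE] := injE _ _ i (j \o f) i_inj.
have [|v vE] := factor_surj (f := q \o u) pS.
  by move=> x /ker_p[k <-]; rewrite /= uE qj.
have [h hE] := lift v.
have [|g gE] := factor_inj (f := u \- (h \o p)) j_inj.
  by move=> x; apply: ker_q; rewrite linearB hE vE subrr.
by exists g => k; apply: j_inj; rewrite gE /= uE pi linear0 subr0.
Qed.

(** Both groups are Ext^2(M, N), computed by a syzygy of [M] or by a cosyzygy of [N]. *)
Lemma ext1_zero_shift M N K P E C (i : {linear K -> P}) (p : {linear P -> M})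
    (j : {linear N -> E}) (q : {linear E -> C}) :
  short_exact i p -> projective P -> short_exact j q -> injective_module E ->
  ext1_zero K N <-> ext1_zero M C.
Proof.
move=> ip projP jq injE; have [i_inj pi ker_p pS] := ip.
have [j_inj qj ker_q qS] := jq; split=> ext.
  apply: (ext1_zero_proj ip projP) => f.
  have [h hE] := ext1_zero_lift ext jq f.
  have [g gE] := injE _ _ i h i_inj.
  by exists (q \o g) => k; rewrite /= gE hE.
apply: (ext1_zero_of_lift jq injE) => f.
have [g gE] := ext _ _ _ _ ip f.
have [h hE] := projP _ _ q g (proj2 (surjP q) qS).
by exists (h \o i) => k; rewrite /= hE gE.
Qed.

Lemma ext_zero_shift n M N E C (j : {linear N -> E}) (q : {linear E -> C}) :
  short_exact j q -> injective_module E ->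
  ext_zero n.+1 M N <-> ext_zero n M C.
Proof.
move=> jq injE; elim: n M => [|n IHn] M; split=> ext.
- have [K [P [i [p [ip projP]]]]] := projective_presentation M.
  by apply/(ext1_zero_shift ip projP jq injE); exact: ext ip projP.
- by move=> K P i p ip projP; apply/(ext1_zero_shift ip projP jq injE).
- by move=> K P i p ip projP; apply/IHn; exact: ext ip projP.
- by move=> K P i p ip projP; apply/IHn; exact: ext ip projP.
Qed.

(** The definition quantifies over all projective presentations. That one is enough is seen by
    shifting to a cosyzygy of [N], a condition that mentions no presentation of [M]. *)
Lemma ext_zeroS n M N K P (i : {linear K -> P}) (p : {linear P -> M}) :
  short_exact i p -> projective P -> ext_zero n K N -> ext_zero n.+1 M N.
Proof.
elim: n M N K P i p => [|n IHn] M N K P i p ip projP ext.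
  have [E [C [j [q [jq injE]]]]] := injective_copresentation N.
  apply/(ext_zero_shift _ _ jq injE).
  by apply/(ext1_zero_shift ip projP jq injE).
have [E [C [j [q [jq injE]]]]] := injective_copresentation N.
apply/(ext_zero_shift _ _ jq injE); apply: IHn ip projP _.
exact/(ext_zero_shift _ _ jq injE).
Qed.

Lemma ext1_zero_injective M N : injective_module N -> ext1_zero M N.
Proof. by move=> injN K P i p [i_inj _ _ _] f; exact: injN. Qed.

Lemma ext1_zero_projective M N : projective M -> ext1_zero M N.
Proof.
move=> projM K P i p [i_inj pi ker_p pS] f.
have [s sE] := projM _ _ p idfun (proj2 (surjP p) pS).
have [|r rE] := factor_inj (f := idfun \- (s \o p)) i_inj.
  by move=> x; apply: ker_p; rewrite linearB sE subrr.
exists (f \o r) => k /=; congr (f _); apply: i_inj.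
by rewrite rE /= pi linear0 subr0.
Qed.

Lemma idim_le_ext n N : idim_le n N -> forall M, ext_zero n M N.
Proof.
elim: n N => [|n IHn] N; first by move=> injN M; exact: ext1_zero_injective.
move=> [E [C [j [q [jq injE dC]]]]] M; apply/(ext_zero_shift _ _ jq injE).
exact: IHn.
Qed.

(** Baer's criterion tests maps on left ideals [I], so the cyclic modules A/I are all that is
    needed. *)
Lemma ext1_zero_cyclic_injective N :
  (forall M, fin_gen M -> ext1_zero M N) -> injective_module N.
Proof.
move=> ext; apply: baer_criterion => I f sI fD fZ.
have fgA : fin_gen (quom sI).
  apply/fin_genP; exists 1%N, (fun=> quom_pi sI 1) => x.
  have [a <-] := quom_pi_surj x; exists (fun=> a).
  by rewrite big_ord1 -linearZ /= /GRing.scale /= mulr1.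
have fL : linear (fun x : subm sI => f (subm_incl sI x)).
  have [_ _ IZ] := sI.
  move=> a x y; rewrite linearP fD; try exact: subm_inclP.
    by rewrite fZ //; exact: subm_inclP.
  by apply: IZ; exact: subm_inclP.
have [g gE] := ext _ fgA _ _ _ _ (short_exact_quom sI) (linear_of fL).
exists (g 1) => a Ia; have [x xE] := subm_incl_surj sI Ia.
have -> : a *: g 1 = g a by rewrite -linearZ; congr (g _); exact: mulr1.
by rewrite -xE gE.
Qed.

Lemma ext_idim_le n N :
  (forall M, fin_gen M -> ext_zero n M N) -> idim_le n N.
Proof.
elim: n N => [|n IHn] N ext; first exact: ext1_zero_cyclic_injective.
have [E [C [j [q [jq injE]]]]] := injective_copresentation N.
exists E, C, j, q; split=> //; apply: IHn => M fgM.
by apply/(ext_zero_shift _ _ jq injE); exact: ext.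
Qed.

Lemma pdim_le_ext n M : pdim_le n M -> forall N, ext_zero n M N.
Proof.
elim: n M => [|n IHn] M; first by move=> projM N; exact: ext1_zero_projective.
move=> [K [P [i [p [ip projP dK]]]]] N.
by apply: ext_zeroS ip projP _; exact: IHn.
Qed.

Lemma ext1_zero_projective_of M : (forall N, ext1_zero M N) -> projective M.
Proof.
move=> ext X Y g f /surjP gS.
exact: ext1_zero_lift (ext _) (short_exact_ker gS) f.
Qed.

Lemma ext_pdim_le n M : (forall N, ext_zero n M N) -> pdim_le n M.
Proof.
elim: n M => [|n IHn] M ext; first exact: ext1_zero_projective_of.
have [K [P [i [p [ip projP]]]]] := projective_presentation M.
by exists K, P, i, p; split=> //; apply: IHn => N; exact: ext ip projP.
Qed.

(** Finitely generated modules already control injective dimension, by Baer's criterion, and a bound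
    on all injective dimensions bounds all projective dimensions. *)
Lemma auslander n : (forall M, fin_gen M -> pdim_le n M) ->
  (forall M, pdim_le n M) /\ (forall N, idim_le n N).
Proof.
move=> dfg; have dinj N : idim_le n N.
  by apply: ext_idim_le => M /dfg /pdim_le_ext.
by split=> // M; apply: ext_pdim_le => N; exact: idim_le_ext.
Qed.

Lemma pdim_le_idim_le n : (forall M, pdim_le n M) -> forall N, idim_le n N.
Proof. by move=> d; apply: (auslander _).2. Qed.

End ExtVanishing.

(** * Comparison with resolutions *)

Section Dimensions.
Variable A : pzRingType.
Implicit Types M N K P Q X Y L E C : lmodType A.

Lemma zero_module_projective M : zero_module M -> projective M.
Proof.
move=> M0 X Y g f _; exists (\0 : M -> X) => x /=.
by rewrite (M0 x) !linear0.
Qed.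

Lemma zero_module_injective M : zero_module M -> injective_module M.
Proof. by move=> M0 X Y i f _; exists (\0 : Y -> M) => x; rewrite /= (M0 (f x)). Qed.

Lemma trivial_submodule M : submodule ([set 0]%classic : set M).
Proof.
by split=> [//|x y -> ->|a x ->]; rewrite ?addr0 ?scaler0.
Qed.

Definition trivial_module : lmodType A := subm (trivial_submodule A^o).

Lemma trivial_moduleP : zero_module trivial_module.
Proof.
move=> x; apply: (@subm_incl_inj _ _ _ (trivial_submodule A^o)).
by rewrite linear0; exact: (subm_inclP x).
Qed.

Lemma projective_iso M N (f : {linear M -> N}) :
  injective f -> (forall y, exists x, f x = y) -> projective M -> projective N.
Proof.
move=> f_inj fS projM X Y g h gS.
have [u uE] := projM _ _ g (h \o f) gS.
have [|v vE] := factor_surj (f := u) fS.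
  by move=> x fx; rewrite (f_inj x 0) ?linear0.
by exists v => y; have [x <-] := fS y; rewrite vE uE.
Qed.

Lemma injective_module_iso M N (f : {linear M -> N}) :
  injective f -> (forall y, exists x, f x = y) ->
  injective_module N -> injective_module M.
Proof.
move=> f_inj fS injN X Y i h i_inj.
have [u uE] := injN _ _ i (f \o h) i_inj.
have [|v vE] := factor_inj (f := u) f_inj; first by move=> x; exact: fS.
by exists v => y; apply: f_inj; rewrite vE uE.
Qed.

Lemma proj_resolution_leP n M : proj_resolution_le M n <-> pdim_le n M.
Proof.
elim: n M => [|n IHn] M; split.
- move=> [P [e [d [/surjP eS /exactP[_ ker_e] dd projP P0]]]].
  apply: (projective_iso (f := e) _ eS (projP 0%N)); apply: linear_inj => x.
  by move=> /ker_e[y <-]; rewrite (P0 1%N _ y) ?linear0.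
- move=> projM; exists (fun i => if i is 0%N then M else trivial_module), idfun.
  exists (fun i => \0 : trivial_module -> (if i is 0%N then M else trivial_module)).
  split.
  + by apply/surjP => y; exists y.
  + by apply/exactP; split=> // y y0; exists 0; exact: (esym y0).
  + by move=> i; apply/exactP; split=> // y _; exists 0; exact/esym/trivial_moduleP.
  + by case=> [|i] //; exact/zero_module_projective/trivial_moduleP.
  + by case=> // i _; exact: trivial_moduleP.
- move=> [P [e [d [/surjP eS /exactP[ed ker_e] dd projP P0]]]].
  have ses := short_exact_ker eS; have [i_inj ei ker_i _] := ses.
  exists (subm (submodule_ker e)), (P 0%N), (subm_incl _), e; split=> //.
  apply/IHn; have [|e' e'E] := factor_inj (f := d 0%N) i_inj.
    by move=> x; apply: ker_i; rewrite ed.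
  exists (fun i => P i.+1), e', (fun i => d i.+1); split=> //.
  + apply/surjP => y; have [x xE] := ker_e _ (ei y); exists x.
    by apply: i_inj; rewrite e'E.
  + have /exactP[d10 ker_d0] := dd 0%N; apply/exactP; split=> [x|x e'x].
      by apply: i_inj; rewrite e'E d10 linear0.
    by apply: ker_d0; rewrite -e'E e'x linear0.
  + by move=> i lt_ni; exact: (P0 i.+1).
- move=> [K [P [i [p [[i_inj pi ker_p pS] projP]]]]].
  move=> /IHn[R [e [d [/surjP eS /exactP[ed ker_e] dd projR R0]]]].
  (* The resolution of [K] is spliced with [P], the composite [i \o e] being the new first
     differential. *)
  pose F k := if k is j.+1 then R j else P.
  pose D k : {linear F k.+1 -> F k} :=
    match k return {linear F k.+1 -> F k} with
    | 0 => i \o e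
    | j.+1 => d j
    end.
  exists F, p, D; split.
  + exact/surjP.
  + apply/exactP; split=> [x|x /ker_p[k <-]]; first exact: pi.
    by have [y <-] := eS k; exists y.
  + case=> [|k]; last exact: dd.
    apply/exactP; split=> [x|x] /=; first by rewrite ed linear0.
    by rewrite -(linear0 i) => /i_inj /ker_e.
  + by case.
  + by case=> // k /R0.
Qed.

Lemma inj_resolution_leP n N : inj_resolution_le N n <-> idim_le n N.
Proof.
elim: n N => [|n IHn] N; split.
- move=> [E [e [d [e_inj /exactP[_ ker_d] dd injE E0]]]].
  apply: (injective_module_iso e_inj _ (injE 0%N)) => y.
  by apply: ker_d; exact: E0.
- move=> injN; exists (fun i => if i is 0%N then N else trivial_module), idfun.
  exists (fun i => \0 : (if i is 0%N then N else trivial_module) -> trivial_module).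
  split=> //.
  + by apply/exactP; split=> // y _; exists y.
  + by move=> i; apply/exactP; split=> // y _; exists 0; exact/esym/trivial_moduleP.
  + by case=> [|i] //; exact/zero_module_injective/trivial_moduleP.
  + by case=> // i _; exact: trivial_moduleP.
- move=> [E [e [d [e_inj /exactP[de ker_d] dd injE E0]]]].
  have sR : submodule (range (d 0%N)) by apply: submodule_image; split.
  have [|q qE] := factor_inj (f := d 0%N) (subm_incl_inj (sN := sR)).
    by move=> x; apply: subm_incl_surj; exists x.
  exists (E 0%N), (subm sR), e, q; split=> //.
    split=> // [k|x qx|y].
    + by apply: (@subm_incl_inj _ _ _ sR); rewrite qE de linear0.
    + by apply: ker_d; rewrite -qE qx linear0.
    + have [x _ xE] := subm_inclP y; exists x; apply: (@subm_incl_inj _ _ _ sR).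
      by rewrite qE xE.
  apply/IHn; exists (fun i => E i.+1), (subm_incl sR), (fun i => d i.+1); split=> //.
  + have /exactP[d10 ker_d1] := dd 0%N; apply/exactP; split=> [y|y /ker_d1 yR].
      by have [x _ <-] := subm_inclP y.
    by apply: subm_incl_surj; have [x <-] := yR; exists x.
  + by move=> i lt_ni; exact: (E0 i.+1).
- move=> [E [C [j [q [[j_inj qj ker_q qS] injE]]]]].
  move=> /IHn[R [e [d [e_inj /exactP[de ker_d] dd injR R0]]]].
  pose F k := if k is l.+1 then R l else E.
  pose D k : {linear F k -> F k.+1} :=
    match k return {linear F k -> F k.+1} with
    | 0 => e \o q
    | l.+1 => d l
    end.
  exists F, j, D; split=> //.
  + apply/exactP; split=> [x|x] /=; first by rewrite qj linear0.
    by rewrite -(linear0 e) => /e_inj /ker_q.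
  + case=> [|k]; last exact: dd.
    apply/exactP; split=> [x|x /ker_d[y <-]]; first exact: de.
    by have [z <-] := qS y; exists z.
  + by case.
  + by case=> // k /R0.
Qed.

Lemma proj_resolution_le_mono M m n :
  (m <= n)%N -> proj_resolution_le M m -> proj_resolution_le M n.
Proof.
move=> mn [P [e [d [? ? ? ? P0]]]]; exists P, e, d; split=> // i ni.
by apply: P0; exact: leq_ltn_trans ni.
Qed.

Lemma inj_resolution_le_mono N m n :
  (m <= n)%N -> inj_resolution_le N m -> inj_resolution_le N n.
Proof.
move=> mn [E [e [d [? ? ? ? E0]]]]; exists E, e, d; split=> // i ni.
by apply: E0; exact: leq_ltn_trans ni.
Qed.

Lemma idim_le_mono N m n : (m <= n)%N -> idim_le m N -> idim_le n N.
Proof.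
move=> mn /inj_resolution_leP dN; apply/inj_resolution_leP.
exact: inj_resolution_le_mono dN.
Qed.

End Dimensions.

(** * Dimensions as extended natural numbers *)

Lemma inf_nat_leP (S : set nat) n :
  (forall k l, (k <= l)%N -> S k -> S l) ->
  le_enat (inf_nat S) (Some n) <-> S n.
Proof.
move=> Smono; case S_inf: (inf_nat S) => [m|] /=.
  have [Sm minm] := (inf_natP S m).1 S_inf.
  by split=> [mn|]; [exact: Smono Sm | exact: minm].
by split=> // Sn; have := (inf_nat_infty S).1 S_inf n.
Qed.

(** Equality of dimensions is reduced to finite bounds, so that infinity needs no separate
    treatment. *)
Lemma enat_eqP (x y : enat) :
  (forall n, le_enat x (Some n) <-> le_enat y (Some n)) -> x = y.
Proof.
case: x y => [m|] [n|] //= xy.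
- by congr Some; apply/eqP; rewrite eqn_leq; apply/andP; split; apply/xy.
- by have /xy := leqnn m.
- by have /xy := leqnn n.
Qed.

Section GlobalDimension.
Variable A : pzRingType.
Implicit Types M N : lmodType A.

Lemma proj_dim_leP M n : le_enat (proj_dim M) (Some n) <-> pdim_le n M.
Proof.
rewrite -proj_resolution_leP; apply: inf_nat_leP => k l.
exact: proj_resolution_le_mono.
Qed.

Lemma inj_dim_leP N n : le_enat (inj_dim N) (Some n) <-> idim_le n N.
Proof.
rewrite -inj_resolution_leP; apply: inf_nat_leP => k l.
exact: inj_resolution_le_mono.
Qed.

Lemma sup_enat_leP (S : set enat) n :
  le_enat (sup_enat S) (Some n) <-> forall x, S x -> le_enat x (Some n).
Proof.
apply: inf_nat_leP => k l kl Sk x /Sk; case: x => //= m mk.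
exact: leq_trans kl.
Qed.

Lemma gl_dim_leP n : le_enat (gl_dim A) (Some n) <-> forall M, pdim_le n M.
Proof.
rewrite sup_enat_leP; split=> [d M|d _ [M ->]]; last exact/proj_dim_leP.
by apply/proj_dim_leP/d; exists M.
Qed.

End GlobalDimension.

(** * The Jacobson radical *)

Section Jacobson.
Variable A : pzRingType.
Implicit Types x a b : A.

Lemma in_jacobson_left_inverse x : in_jacobson x ->
  forall a, exists u : A, u * (1 - a * x) = 1.
Proof.
move=> Jx a; apply: contrapT => nu.
pose B : set A^o := [set y : A^o | exists u : A, y = u * (1 - a * x)]%classic.
have sB : submodule B.
  split; first by exists 0; rewrite mul0r.
    by move=> _ _ [u ->] [v ->]; exists (u + v); rewrite mulrDl.
  by move=> c _ [u ->]; exists (c * u); rewrite -mulrA.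
pose good (G : set A^o) := ~ G 1.
have gB : good B by move=> [u uE]; apply: nu; exists u.
have [|G [sG gG BG maxG]] := Zorn_submodule sB gB.
  by move=> F _ _ FP [G /FP[_ gG] /gG].
have [_ GD GZ] := sG.
have GJ : maximal_left_ideal G.
  split=> // [GT|K sK GK]; first by apply: gG; rewrite GT.
  have [K1|nK1] := EM (K 1); last by left; apply: maxG.
  right; apply/seteqP; split=> // y _; have [_ _ KZ] := sK.
  by rewrite -[y]mulr1; exact: (KZ y _ K1).
apply: gG; rewrite -(subrK (a * x) 1); apply: GD; last exact: (GZ a _ (Jx _ GJ)).
by apply: BG; exists 1; rewrite mul1r.
Qed.

Lemma in_jacobson_of_left_inverse x :
  (forall a, exists u : A, u * (1 - a * x) = 1) -> in_jacobson x.
Proof.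
move=> ux I [sI nI maxI]; apply: contrapT => nIx.
pose K : set A^o := [set y : A^o | exists z a, I z /\ y = z + a * x]%classic.
have [I0 ID IZ] := sI.
have sK : submodule K.
  split; first by exists 0, 0; rewrite mul0r addr0.
    move=> _ _ [y [a [Iy ->]]] [z [b [Iz ->]]]; exists (y + z), (a + b).
    by rewrite mulrDl addrACA; split=> //; exact: ID.
  move=> c _ [y [a [Iy ->]]]; exists (c * y), (c * a).
  by rewrite -mulrA -mulrDr; split=> //; exact: (IZ c).
have IK : (I `<=` K)%classic by move=> y Iy; exists y, 0; rewrite mul0r addr0.
case: (maxI K sK IK) => KE.
  by apply: nIx; rewrite -KE; exists 0, 1; rewrite mul1r add0r.
have [y [a [Iy yE]]] : K 1 by rewrite KE.
have [u uE] := ux a; apply: nI; apply/seteqP; split=> // z _.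
have I1 : I 1 by rewrite -uE yE addrK; exact: (IZ u _ Iy).
by rewrite -[z]mulr1; exact: (IZ z _ I1).
Qed.

Lemma in_jacobson0 : in_jacobson (0 : A).
Proof. by move=> I [[]]. Qed.

Lemma in_jacobsonD x y : in_jacobson x -> in_jacobson y -> in_jacobson (x + y).
Proof.
move=> Jx Jy I mI; have [[_ ID _] _ _] := mI.
by apply: ID; [exact: Jx | exact: Jy].
Qed.

Lemma in_jacobsonMl a x : in_jacobson x -> in_jacobson (a * x).
Proof. by move=> Jx I mI; have [[_ _ IZ] _ _] := mI; apply: (IZ a); exact: Jx. Qed.

Lemma in_jacobsonMr x b : in_jacobson x -> in_jacobson (x * b).
Proof.
move=> Jx; apply: in_jacobson_of_left_inverse => a.
have [u uE] := in_jacobson_left_inverse Jx (b * a).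
(* The identity (1 - rs)^-1 = 1 + r (1 - sr)^-1 s with r = ax and s = b, used for left inverses. *)
exists (1 + a * x * u * b); rewrite mulrDl mul1r.
have -> : a * x * u * b * (1 - a * (x * b)) = a * x * (u * (1 - b * a * x)) * b.
  by rewrite !mulrBr !mulrBl !mulr1 !mulrA.
by rewrite uE mulr1 mulrA subrK.
Qed.

(** A left inverse [u] of 1 - x equals 1 + ux, so it has a left inverse itself, which must be 1 -
    x. *)
Lemma in_jacobson_right_inverse x : in_jacobson x -> exists u : A, (1 - x) * u = 1.
Proof.
move=> Jx; have [u uE] := in_jacobson_left_inverse Jx 1.
rewrite mul1r in uE; exists u.
have [w wE] := in_jacobson_left_inverse Jx (- u).
have wu : w * u = 1.
  by rewrite -wE; congr (w * _); rewrite mulNr opprK -uE mulrBr mulr1 subrK.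
have -> : 1 - x = w * (u * (1 - x)) by rewrite mulrA wu mul1r.
by rewrite uE mulr1.
Qed.

End Jacobson.

Lemma anti_oppr (A B : pzRingType) (t : anti_morphism A B) x : t (- x) = - t x.
Proof.
have t0 : t 0 = 0 by apply: (addrI (t 0)); rewrite -antiD !addr0.
by apply/eqP; rewrite -addr_eq0 -antiD addNr t0.
Qed.

(** Left-right symmetry of the radical: right inverses in [A] become left inverses in [B]. *)
Lemma in_jacobson_anti (A B : pzRingType) (t : anti_morphism A B)
    (s : anti_morphism B A) (b : B) :
  (forall a, t (s a) = a) -> (forall b, s (t b) = b) ->
  in_jacobson (t b : A) -> in_jacobson b.
Proof.
move=> ts st Jb; apply: in_jacobson_of_left_inverse => a.
have [v vE] := in_jacobson_right_inverse (in_jacobsonMr (t a) Jb).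
exists (s v); apply: (can_inj st).
by rewrite antiM ts antiD anti_oppr antiM anti1.
Qed.

(** * The submodule JM, Nakayama's lemma and projective covers *)

Section RadicalMultiple.
Variable A : pzRingType.
Implicit Types M N K P Q W Y : lmodType A.

(** JM as an intersection of submodules, so that membership is its own induction principle. *)
Definition jacobson_mul M : set M :=
  [set z | forall S : set M, submodule S ->
     (forall (a : A) x, in_jacobson a -> S (a *: x)) -> S z]%classic.

Lemma submodule_jacobson_mul M : submodule (@jacobson_mul M).
Proof.
split=> [S [] //|x y Jx Jy S sS JS|a x Jx S sS JS]; have [_ SD SZ] := sS.
  by apply: SD; [exact: Jx | exact: Jy].
by apply: SZ; exact: Jx.
Qed.

Lemma jacobson_mul_scale M (a : A) (x : M) :
  in_jacobson a -> jacobson_mul (a *: x).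
Proof. by move=> Ja S _; exact. Qed.

Lemma jacobson_mul_linear M N (f : {linear M -> N}) x :
  jacobson_mul x -> jacobson_mul (f x).
Proof.
move=> Jx; apply: (Jx [set y | jacobson_mul (f y)]%classic).
  exact: (submodule_preimage f (submodule_jacobson_mul N)).
by move=> a y Ja /=; rewrite linearZ; exact: jacobson_mul_scale.
Qed.

Lemma jacobson_mul_eq0 W (w : W) :
  (forall (a : A) (x : W), in_jacobson a -> a *: x = 0) -> jacobson_mul w -> w = 0.
Proof.
move=> JW Jw; apply: (Jw [set 0]%classic); first exact: trivial_submodule.
by move=> a x; exact: JW.
Qed.

(** Induction on the number of generators of [M] modulo [N]. After [g0] is adjoined to [N] one gets
    all of [M], so [g0] lies in N + J g0, and 1 - j is left invertible for [j] in J. *)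
Lemma nakayama_aux n M (N : set M) (g : 'I_n -> M) :
  submodule N -> (forall x, exists c : 'I_n -> A, N (x - \sum_i c i *: g i)) ->
  (forall x, exists y z, [/\ N y, jacobson_mul z & x = y + z]) -> forall x, N x.
Proof.
elim: n N g => [|n IHn] N g sN Ng NJ.
  by move=> x; have [c] := Ng x; rewrite big_ord0 subr0.
have [N0 ND NZ] := sN; pose g0 := g ord0.
pose N' : set M := [set x | exists y (c : A), N y /\ x = y + c *: g0]%classic.
have NN' x : N x -> N' x by move=> Nx; exists x, 0; rewrite scale0r addr0.
have N'T : forall x, N' x.
  apply: (IHn _ (g \o lift ord0)).
  - split; first exact: NN'.
      move=> _ _ [x [a [Nx ->]]] [y [b [Ny ->]]]; exists (x + y), (a + b).
      by rewrite scalerDl addrACA; split=> //; exact: ND.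
    move=> c _ [x [a [Nx ->]]]; exists (c *: x), (c * a).
    by rewrite scalerDr scalerA; split=> //; exact: NZ.
  - move=> x; have [c Nc] := Ng x; exists (c \o lift ord0).
    exists (x - \sum_i c i *: g i), (c ord0); split=> //.
    by rewrite big_ord_recl opprD addrA addrAC subrK.
  - by move=> x; have [y [z [Ny Jz ->]]] := NJ x; exists y, z; split=> //; exact: NN'.
suff Ng0 : N g0.
  by move=> x; have [y [c [Ny ->]]] := N'T x; apply: ND => //; exact: NZ.
pose NJg0 : set M := [set z | exists y (j : A),
  [/\ N y, in_jacobson j & z = y + j *: g0]]%classic.
(* As M = N + A g0, the submodule JM lies in N + J g0; this uses that J is a two-sided ideal. *)
have JE z : jacobson_mul z -> NJg0 z.
  apply.
    split; first by exists 0, 0; rewrite scale0r addr0; split=> //; exact: in_jacobson0.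
      move=> _ _ [x [a [Nx Ja ->]]] [y [b [Ny Jb ->]]]; exists (x + y), (a + b).
      by rewrite scalerDl addrACA; split=> //; [exact: ND | exact: in_jacobsonD].
    move=> c _ [x [a [Nx Ja ->]]]; exists (c *: x), (c * a).
    by rewrite scalerDr scalerA; split=> //; [exact: NZ | exact: in_jacobsonMl].
  move=> a x Ja; have [y [c [Ny ->]]] := N'T x; exists (a *: y), (a * c).
  by rewrite scalerDr scalerA; split=> //; [exact: NZ | exact: in_jacobsonMr].
have [y [z [Ny /JE[y' [j [Ny' Jj ->]]] g0E]]] := NJ g0.
have [u uE] := in_jacobson_left_inverse Jj 1; rewrite mul1r in uE.
rewrite -[g0]scale1r -uE -scalerA; apply: NZ.
rewrite scalerBl scale1r {1}g0E addrA addrK; exact: ND.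
Qed.

Lemma nakayama M (N : set M) : fin_gen M -> submodule N ->
  (forall x, exists y z, [/\ N y, jacobson_mul z & x = y + z]) -> forall x, N x.
Proof.
move=> /fin_genP[n [g Mg]] sN; apply: (nakayama_aux (g := g)) => // x.
by have [c ->] := Mg x; exists c; rewrite subrr; case: sN.
Qed.

(** It is enough that each coordinate of [x] lies in every maximal left ideal [I]. Otherwise [K] and
    the preimage of [I] under that coordinate would span [P], the preimage would be [P], and the
    coordinate of [x] would lie in [I] after all. *)
Lemma superfluous_jacobson P (K : set P) x :
  projective P -> fin_gen P -> submodule K -> superfluous K -> K x ->
  jacobson_mul x.
Proof.
move=> projP fgP sK supK Kx; have [n [phi [g gE]]] := dual_basis projP fgP.
rewrite [x]gE; apply: submodule_sum => [|i]; first exact: submodule_jacobson_mul.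
apply: jacobson_mul_scale => I [sI nI maxI]; apply: contrapT => nIx.
have [I0 ID IZ] := sI; have [_ _ KZ] := sK.
pose L : set A^o :=
  [set y : A^o | exists z (a : A), I z /\ y = z + a *: phi i x]%classic.
have sL : submodule L.
  split; first by exists 0, 0; rewrite scale0r addr0.
    move=> _ _ [y [a [Iy ->]]] [z [b [Iz ->]]]; exists (y + z), (a + b).
    by rewrite scalerDl addrACA; split=> //; exact: ID.
  move=> c _ [y [a [Iy ->]]]; exists (c *: y), (c * a).
  by rewrite scalerDr scalerA; split=> //; exact: IZ.
have IL : (I `<=` L)%classic by move=> y Iy; exists y, 0; rewrite scale0r addr0.
case: (maxI L sL IL) => LE.
  by apply: nIx; rewrite -LE; exists 0, 1; rewrite scale1r add0r.
have NT := supK _ (submodule_preimage (phi i) sI).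
apply: nIx; suff : [set y | I (phi i y)]%classic x by [].
rewrite NT // => y; have [z [a [Iz yE]]] : L (phi i y) by rewrite LE.
exists (a *: x), (y - a *: x); split; first exact: KZ.
  by rewrite /= linearB linearZ yE addrK.
by rewrite addrC subrK.
Qed.

Lemma projective_cover_fin_gen P M (p : {linear P -> M}) :
  projective_cover p -> fin_gen M -> fin_gen P.
Proof.
move=> [projP pS supK] /fin_gen_cover[n [e eS]].
have [h hE] := @projective_free A 'I_n _ _ p e pS.
apply: (fin_gen_image (f := h)) => [|y]; first exact: free_fin_gen.
have sR : submodule (range h) by apply: submodule_image; split.
suff [x _ <-] : range h y by exists x.
rewrite (supK _ sR) // => x; have [z zE] := eS (p x).
exists (x - h z), (h z); split; [|by exists z|by rewrite subrK].
by rewrite /ker /= linearB hE zE subrr.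
Qed.

Lemma projective_cover_ker P M (p : {linear P -> M}) x :
  projective_cover p -> fin_gen M -> p x = 0 -> jacobson_mul x.
Proof.
move=> pc fgM px; have [projP _ supK] := pc.
exact: superfluous_jacobson (projective_cover_fin_gen pc fgM) (submodule_ker p) supK px.
Qed.

End RadicalMultiple.

(** * Detecting projective dimension *)

Section Noetherian.
Variable A : pzRingType.
Hypothesis noethA : left_noetherian A.
Implicit Types M N K P Q W Y : lmodType A.

(** Generation by a list, phrased through submodules, lets generating lists be concatenated without
    reindexing sums. *)
Definition spanned M (N : set M) (s : seq M) :=
  (forall x, x \in s -> N x) /\
  forall x, N x -> forall S : set M, submodule S -> (forall y, y \in s -> S y) -> S x.

Lemma noetherian_spanned M n (g : 'I_n -> M) (N : set M) : submodule N ->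
  (forall x, N x -> exists c : 'I_n -> A, x = \sum_i c i *: g i) ->
  exists s, spanned N s.
Proof.
elim: n g N => [|n IHn] g N sN Ng.
  exists [::]; split=> // x /Ng[c ->] S [S0 _ _] _.
  by rewrite big_ord0.
have [N0 ND NZ] := sN; pose g' := g \o lift ord0.
(* The left ideal of leading coefficients of [N]. Lifts [m] of its generators, with generators of
   the part [N'] of [N] free of [g ord0], generate [N]. *)
pose I : set A^o := [set a | exists c : 'I_n -> A,
  N ((a : A) *: g ord0 + \sum_i c i *: g' i)]%classic.
have sI : submodule I.
  split.
  - by exists (fun=> 0); rewrite scale0r add0r big1 // => i _; rewrite scale0r.
  - move=> a b [c Na] [d Nb]; exists (fun i => c i + d i).
    rewrite scalerDl; under eq_bigr do rewrite scalerDl.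
    by rewrite big_split addrACA; exact: ND.
  - move=> e a [c Na]; exists (fun i => e * c i).
    rewrite -scalerA; under eq_bigr do rewrite -scalerA.
    by rewrite -scaler_sumr -scalerDr; exact: NZ.
have [k [h Ih]] := noethA sI.
have Ihi i : I (h i).
  rewrite Ih; exists (fun j => (j == i)%:R); rewrite (bigD1 i) //= eqxx scale1r.
  by rewrite big1 ?addr0 // => j /negbTE ->; rewrite scale0r.
have [c cN] := choice Ihi.
pose m i := (h i : A) *: g ord0 + \sum_j c i j *: g' j.
pose N' : set M :=
  [set x | N x /\ exists d : 'I_n -> A, x = \sum_i d i *: g' i]%classic.
have [|x [_ //]|s [sN' Nspan]] := IHn g' N'.
  split=> [|x y [Nx [a xE]] [Ny [b yE]]|e x [Nx [a xE]]].
  - by split=> //; exists (fun=> 0); rewrite big1 // => i _; rewrite scale0r.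
  - split; first exact: ND.
    exists (fun i => a i + b i); rewrite xE yE -big_split.
    by apply: eq_bigr => i _; rewrite scalerDl.
  - split; first exact: NZ.
    exists (fun i => e * a i); rewrite xE scaler_sumr.
    by apply: eq_bigr => i _; rewrite scalerA.
exists (s ++ map m (enum 'I_k)); split=> [x|x Nx S sS Ss].
  by rewrite mem_cat => /orP[/sN'[]|/mapP[i _ ->]] //; exact: cN.
have Sm i : S (m i).
  by apply: Ss; rewrite mem_cat; apply/orP; right; apply: map_f; rewrite mem_enum.
have [a aE] := Ng _ Nx; rewrite big_ord_recl in aE.
have [d dE] : exists d : 'I_k -> A, a ord0 = \sum_i d i *: h i.
  suff : I (a ord0) by rewrite Ih => -[d dE]; exists d.
  by exists (a \o lift ord0); rewrite -aE.
have NS : S (\sum_i d i *: m i).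
  by apply: submodule_sum => // i; case: sS => _ _; exact.
rewrite -(subrK (\sum_i d i *: m i) x); have [_ SD _] := sS; apply: SD => //.
apply: Nspan => //; last by move=> y ys; apply: Ss; rewrite mem_cat ys.
split.
  apply: submoduleB => //; apply: submodule_sum => // i; apply: NZ; exact: cN.
exists (fun j => a (lift ord0 j) - \sum_i d i * c i j).
rewrite aE dE scaler_suml.
under [X in _ - X]eq_bigr do rewrite scalerDr scalerA.
rewrite big_split opprD addrACA subrr add0r.
under [RHS]eq_bigr do rewrite scalerBl scaler_suml.
rewrite sumrB; congr (_ - _); rewrite exchange_big; apply: eq_bigr => i _.
by rewrite scaler_sumr; apply: eq_bigr => j _; rewrite scalerA.
Qed.

Lemma noetherian_fin_gen M N (i : {linear N -> M}) :
  fin_gen M -> injective i -> fin_gen N.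
Proof.
move=> /fin_genP[n [g Mg]] i_inj.
have sR : submodule (range i) by apply: submodule_image; split.
have [s [sR' Rs]] := noetherian_spanned sR (fun x _ => Mg x).
have sP (k : 'I_(size s)) : exists x, i x = s`_k.
  by have [x _ xE] := sR' _ (mem_nth 0 (ltn_ord k)); exists x.
have [h hE] := choice sP; apply/fin_genP; exists (size s), h => x.
pose S : set M := [set y | exists c : 'I_(size s) -> A, y = \sum_k c k *: s`_k]%classic.
have sS : submodule S.
  split.
  - by exists (fun=> 0); rewrite big1 // => k _; rewrite scale0r.
  - move=> _ _ [a ->] [b ->]; exists (fun k => a k + b k).
    by rewrite -big_split; apply: eq_bigr => k _; rewrite scalerDl.
  - move=> e _ [a ->]; exists (fun k => e * a k).
    by rewrite scaler_sumr; apply: eq_bigr => k _; rewrite scalerA.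
have [|y ys|c cE] := Rs (i x) _ S sS; first by exists x.
  have lt_ys : (index y s < size s)%N by rewrite index_mem.
  exists (fun k => (k == Ordinal lt_ys)%:R); rewrite (bigD1 (Ordinal lt_ys)) //=.
  rewrite eqxx scale1r nth_index // big1 ?addr0 // => k /negbTE ->.
  by rewrite scale0r.
exists c; apply: i_inj; rewrite cE linear_sum; apply: eq_bigr => k _.
by rewrite linearZ /= hE.
Qed.

End Noetherian.

Definition annihilator_jacobson (A : pzRingType) (W : lmodType A) :=
  forall b : A, in_jacobson b <-> forall w : W, b *: w = 0.

Section Detection.
Variable A : pzRingType.
Hypotheses (noethA : left_noetherian A) (perfA : left_semiperfect A).
Variable W : lmodType A.
Hypothesis annW : annihilator_jacobson W.
Implicit Types M N K P Q Y : lmodType A.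

Lemma jacobson_mul_kill P (f : {linear P -> W}) x : jacobson_mul x -> f x = 0.
Proof.
move=> /(jacobson_mul_linear f); apply: jacobson_mul_eq0 => a w /annW; exact.
Qed.

(** For a coordinate [phi i] of the projective cover [Q] and [w] in [W], the map sending [y] to
    [phi i y *: w] kills JQ, so it factors through [K] and vanishes. Hence all coordinates lie in
    the annihilator J, so Q = JQ and Nakayama applies. *)
Lemma hom_eq0_zero_module K : fin_gen K ->
  (forall f : {linear K -> W}, forall x, f x = 0) -> zero_module K.
Proof.
move=> fgK K0; have [Q [q qc]] := perfA fgK.
have [projQ /surjP qS _] := qc; have fgQ := projective_cover_fin_gen qc fgK.
have [n [phi [g gE]]] := dual_basis projQ fgQ.
have Jphi i x : in_jacobson (phi i x : A).
  apply/annW => w.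
  have fL : linear (fun y => (phi i y : A) *: w).
    by move=> a y z; rewrite linearP scalerDl scalerA.
  have [|f fE] := factor_surj (f := linear_of fL) qS.
    by move=> y qy; apply: jacobson_mul_kill; exact: projective_cover_ker qc fgK qy.
  by rewrite -[LHS]/(linear_of fL x) -fE K0.
have Q0 (x : Q) : x = 0.
  apply: (nakayama (N := [set 0]%classic) fgQ) => [|y].
    exact: trivial_submodule.
  exists 0, y; rewrite add0r; split=> //; rewrite [y]gE.
  apply: submodule_sum => [|i]; first exact: submodule_jacobson_mul.
  exact: jacobson_mul_scale.
by move=> y; have [x <-] := qS y; rewrite (Q0 x) linear0.
Qed.

Lemma ext_zero_pdim_le n Y : fin_gen Y -> ext_zero n Y W -> pdim_le n Y.
Proof.
elim: n Y => [|n IHn] Y fgY ext; have [P [p pc]] := perfA fgY;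
  have [projP /surjP pS _] := pc; have fgP := projective_cover_fin_gen pc fgY;
  have ip := short_exact_ker pS; have [i_inj pi ker_p _] := ip;
  have fgK := noetherian_fin_gen noethA fgP i_inj.
  (* Every map from the kernel to [W] extends to [P], hence kills JP, which contains the kernel. *)
  have K0 : zero_module (subm (submodule_ker p)).
    apply: hom_eq0_zero_module => // f x; have [g <-] := ext _ _ _ _ ip f.
    by apply: jacobson_mul_kill; exact: projective_cover_ker pc fgY (pi x).
  apply: (projective_iso _ pS projP); apply: linear_inj => x /ker_p[k <-].
  by rewrite (K0 k) linear0.
exists (subm (submodule_ker p)), P, (subm_incl _), p; split=> //.
by apply: IHn => //; exact: ext ip projP.
Qed.

Lemma idim_le_pdim_le n : idim_le n W -> forall Y, fin_gen Y -> pdim_le n Y.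
Proof. by move=> dW Y fgY; apply: ext_zero_pdim_le => //; exact: idim_le_ext. Qed.

End Detection.

Section ModJacobson.
Variable A : pzRingType.
Let A0 : lmodType A := mod_jacobson A.

Lemma pi_jacobson_linear : linear (@pi_jacobson A : A^o -> A0).
Proof. by move=> a x y; rewrite pi_jacobsonD pi_jacobson_scale. Qed.

Definition pi_jac : {linear A^o -> A0} := linear_of pi_jacobson_linear.

Lemma pi_jac_eq0 x : pi_jac x = 0 <-> in_jacobson x.
Proof. by rewrite -{1}(linear0 pi_jac) -{2}[x]subr0; exact: pi_jacobson_eq. Qed.

Lemma mod_jacobson_annihilator : annihilator_jacobson A0.
Proof.
move=> b; split=> [Jb w|b0].
  have [x <-] := pi_jacobson_surj w; rewrite -[LHS]/(b *: pi_jac x) -linearZ.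
  by apply/pi_jac_eq0; exact: in_jacobsonMr.
apply/pi_jac_eq0; have := b0 (pi_jac 1); rewrite -linearZ /=.
by rewrite [X in pi_jacobson X]mulr1.
Qed.

Lemma mod_jacobson_fin_gen : fin_gen A0.
Proof.
apply/fin_genP; exists 1%N, (fun=> pi_jac 1) => x.
have [a <-] := pi_jacobson_surj x; exists (fun=> a).
by rewrite big_ord1 -linearZ; congr pi_jacobson; exact/esym/mulr1.
Qed.

End ModJacobson.

(** * Passing between left and right modules *)

Section Duality.
Variables (A B : pzRingType) (t : anti_morphism A B) (s : anti_morphism B A).
Hypotheses (ts : forall a, t (s a) = a) (st : forall b, s (t b) = b).

(** A module and its dual have corresponding annihilators because characters separate points, and
    the radical is left-right symmetric. *)
Lemma dual_annihilator (W : lmodType A) :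
  annihilator_jacobson W -> annihilator_jacobson (dual t W).
Proof.
move=> annW b; split=> [Jb c|b0].
  apply: dualP => w; rewrite dual_scale_app.
  have -> : t b *: w = 0.
    by apply: (annW _).1; apply: (in_jacobson_anti st ts); rewrite st.
  by rewrite dual_app0.
apply: (in_jacobson_anti ts st); apply/annW => w.
apply/eqP/negP => /negP/(dual_separates t)[c].
by rewrite -dual_scale_app b0 eqxx.
Qed.

Lemma dual_idim_le n (M : lmodType A) : pdim_le n M -> idim_le n (dual t M).
Proof.
elim: n M => [|n IHn] M; first exact: injective_dual ts st.
move=> [K [P [i [p [ip projP dK]]]]].
have [i' i'E] := dual_map_ex t i; have [p' p'E] := dual_map_ex t p.
exists (dual t P), (dual t K), p', i'; split; last exact: IHn.
  exact: dual_short_exact i'E p'E ip.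
exact: injective_dual ts st projP.
Qed.

End Duality.

Lemma pdim_mod_jacobson_gl_dim (A : pzRingType) n :
  semiperfect A -> noetherian A -> pdim_le n (mod_jacobson A : lmodType A) ->
  forall M : lmodType A, pdim_le n M.
Proof.
move=> [perfA perfAc] [noethA noethAc] dA0.
have := dual_idim_le (t := to_converse A) (s := of_converse A)
  (fun=> erefl) (fun=> erefl) dA0.
have annA0 := dual_annihilator (t := to_converse A) (s := of_converse A)
  (fun=> erefl) (fun=> erefl) (@mod_jacobson_annihilator A).
(* The dual of the left module A/J bounds finitely generated right modules, among them the right
   module A/J; its dual in turn bounds the left modules. *)
move=> /(idim_le_pdim_le noethAc perfAc annA0) /(_ _ (@mod_jacobson_fin_gen A^c)).
move=> /(dual_idim_le (t := of_converse A) (s := to_converse A)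
  (fun=> erefl) (fun=> erefl)).
have annA0c := dual_annihilator (t := of_converse A) (s := to_converse A)
  (fun=> erefl) (fun=> erefl) (@mod_jacobson_annihilator A^c).
move=> /(idim_le_pdim_le noethA perfA annA0c) dfg.
exact: (auslander dfg).1.
Qed.

(** * Syzygies of A/J *)

Section Syzygies.
Variable A : pzRingType.
Implicit Types M N K L P Q X Y : lmodType A.

Lemma isomorphicP M N : isomorphic M N <->
  exists f : {linear M -> N}, injective f /\ forall y, exists x, f x = y.
Proof.
split=> -[f].
  case=> g fK gK; exists f.
  by split; [exact: can_inj fK | move=> y; exists (g y)].
move=> [f_inj fS]; have [g gE] := choice fS; exists f, g => //.
by move=> x; apply: f_inj; rewrite gE.
Qed.

Lemma short_exact_iso K P M L (i : {linear K -> P}) (p : {linear P -> L})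
    (f : {linear M -> L}) :
  injective f -> (forall y, exists x, f x = y) -> short_exact i p ->
  exists p' : {linear P -> M}, short_exact i p'.
Proof.
move=> f_inj fS [i_inj pi ker_p pS].
have [p' p'E] := factor_inj (f := p) f_inj (fun x => fS _).
exists p'; split=> // [k|x p'x|y].
- by apply: f_inj; rewrite p'E pi linear0.
- by apply: ker_p; rewrite -p'E p'x linear0.
- by have [x xE] := pS (f y); exists x; apply: f_inj; rewrite p'E.
Qed.

Lemma ext_zero_iso n M L N : isomorphic M L -> ext_zero n M N -> ext_zero n L N.
Proof.
move=> /isomorphicP[f [f_inj fS]]; case: n => [|n] ext K P i p.
  by move=> /(short_exact_iso f_inj fS)[p']; exact: ext.
by move=> /(short_exact_iso f_inj fS)[p'] ip' projP; exact: ext ip' projP.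
Qed.

Lemma isomorphic_sym M N : isomorphic M N -> isomorphic N M.
Proof.
case=> f [g fK gK]; have gL : linear g.
  by move=> a x y; apply: (can_inj fK); rewrite linearP !gK.
by exists (linear_of gL); exists f.
Qed.

Lemma idim_le_iso n M N : isomorphic M N -> idim_le n N -> idim_le n M.
Proof.
move=> /isomorphicP[f [f_inj fS]]; case: n => [|n].
  exact: (injective_module_iso f_inj fS).
move=> [E [C [j [q [[j_inj qj ker_q qS] injE dC]]]]].
exists E, C, (j \o f), q; split=> //; split=> //.
- exact: inj_comp.
- by move=> k; exact: qj.
- by move=> x /ker_q[y <-]; have [z <-] := fS y; exists z.
Qed.

(** With the shift built into [ext_zero], this and the converse [ext_zero_syzygy] compare
    Ext^(i+j+1)(M, N) with Ext^(i+1)(L, N). *)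
Lemma syzygy_ext_zero i j M L N :
  syzygy j M L -> ext_zero (i + j) M N -> ext_zero i L N.
Proof.
elim: j i L => [|j IHj] i L; first by rewrite addn0; exact: ext_zero_iso.
move=> [L' [P [p [k [syzL' [projP pS _] k_inj kp]]]]]; rewrite addnS -addSn.
by move=> /(IHj _ _ syzL') ext; exact: ext (short_exactP k_inj kp pS) projP.
Qed.

Lemma ext_zero_syzygy i j M L N :
  syzygy j M L -> ext_zero i L N -> ext_zero (i + j) M N.
Proof.
elim: j i L => [|j IHj] i L.
  by rewrite addn0 => /isomorphic_sym; exact: ext_zero_iso.
move=> [L' [P [p [k [syzL' [projP pS _] k_inj kp]]]]] ext; rewrite addnS -addSn.
by apply: IHj syzL' _; exact: ext_zeroS (short_exactP k_inj kp pS) projP ext.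
Qed.

Lemma syzygy_pdim_le i j M L : syzygy j M L -> pdim_le i L -> pdim_le (i + j) M.
Proof.
move=> syzL dL; apply: ext_pdim_le => N.
by apply: ext_zero_syzygy syzL _; exact: pdim_le_ext.
Qed.

Lemma syzygy_idim_lower n k M N :
  syzygy n M N -> ~ zero_module N -> idim_le k N -> (n <= k)%N.
Proof.
case: n => [//|n] [L [P [p [i [syzL [projP pS supK] i_inj ip]]]]] N0 dN.
rewrite ltnNge; apply/negP => kn; apply: N0 => x.
have ext : ext_zero n M N by apply: idim_le_ext; exact: idim_le_mono kn dN.
have [g gE] := syzygy_ext_zero (i := 0) syzL ext _ _ _ _
  (short_exactP i_inj ip pS) idfun.
have [pi _] := (exactP i p).1 ip.
have gT := supK _ (submodule_ker g).
have {}gT : forall y, ker g y.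
  move=> y; rewrite gT // => z; exists (i (g z)), (z - i (g z)).
  by rewrite subrKC /ker /= linearB gE subrr; split=> //; exact: pi.
by rewrite -[x]/(idfun x) -gE; exact: gT.
Qed.

(** The dual basis presents [P] as a direct summand of a finite power of [A], so maps are extended
    one coordinate at a time. *)
Lemma ext_zero_fg_projective n X P : projective P -> fin_gen P ->
  ext_zero n X A^o -> ext_zero n X P.
Proof.
move=> projP fgP; have [m [phi [g gE]]] := dual_basis projP fgP.
elim: n X => [|n IHn] X ext; last first.
  by move=> K Q i p ip projQ; apply: IHn; exact: ext ip projQ.
move=> K Q i p ip f; have [h hE] := choice (fun l => ext _ _ _ _ ip (phi l \o f)).
have hL : linear (fun x => \sum_l (h l x : A) *: g l).
  move=> a x y; rewrite scaler_sumr -big_split; apply: eq_bigr => l _.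
  by rewrite linearP scalerDl scalerA.
exists (linear_of hL) => k; rewrite [f k]gE.
by apply: eq_bigr => l _; rewrite hE.
Qed.

Lemma idim_le_fg_projective n P : projective P -> fin_gen P ->
  idim_le n (A^o : lmodType A) -> idim_le n P.
Proof.
move=> projP fgP dA; apply: ext_idim_le => M _.
by apply: ext_zero_fg_projective => //; exact: idim_le_ext.
Qed.

(** The part Ext^(n+1)(X, P) -> Ext^(n+1)(X, L) -> Ext^(n+2)(X, N) of the long exact sequence. *)
Lemma ext_zero_quotient n X N P L (i : {linear N -> P}) (p : {linear P -> L}) :
  short_exact i p -> ext_zero n X P -> ext_zero n.+1 X N -> ext_zero n X L.
Proof.
move=> ip; elim: n X => [|n IHn] X extP extN; last first.
  move=> K Q j q jq projQ; apply: IHn; first exact: extP jq projQ.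
  exact: extN jq projQ.
have [K [Q [j [q [jq projQ]]]]] := projective_presentation X.
apply: (ext1_zero_proj jq projQ) => f.
have [h hE] := ext1_zero_lift (extN _ _ _ _ jq projQ) ip f.
have [g gE] := extP _ _ _ _ jq h.
by exists (p \o g) => k; rewrite /= gE hE.
Qed.

Lemma syzygy_fin_gen n M K : left_noetherian A ->
  fin_gen M -> syzygy n M K -> fin_gen K.
Proof.
move=> noethA fgM; elim: n K => [|n IHn] K.
  by move=> /isomorphicP[f [_ fS]]; exact: fin_gen_image fgM fS.
move=> [L [P [p [i [/IHn fgL pc i_inj _]]]]].
exact: noetherian_fin_gen (projective_cover_fin_gen pc fgL) i_inj.
Qed.

Lemma syzygy_idim_le n k M N : left_noetherian A -> idim_le k (A^o : lmodType A) ->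
  fin_gen M -> syzygy n M N -> idim_le k N -> idim_le k M.
Proof.
move=> noethA dA fgM; elim: n N => [|n IHn] N; first exact: idim_le_iso.
move=> [L [P [p [i [syzL pc i_inj ip]]]]] dN; apply: (IHn L) => //.
have [projP pS _] := pc; have fgL := syzygy_fin_gen noethA fgM syzL.
have fgP := projective_cover_fin_gen pc fgL.
apply: ext_idim_le => X _.
apply: (ext_zero_quotient (short_exactP i_inj ip pS)).
  by apply: idim_le_ext; exact: idim_le_fg_projective.
by apply: idim_le_ext; exact: idim_le_mono dN.
Qed.

(* As theta_l lifts along [P -> L ~ A/J], the identity of Q/JQ lifts to a map
   [h : N -> Q]; then [h \o q] is the identity modulo JQ, so it is onto by
   Nakayama and splits, and its kernel, being a direct summand contained in JQ,
   is zero. *)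
Lemma first_syzygy_projective N P L (i : {linear N -> P}) (p : {linear P -> L}) :
  left_noetherian A -> left_semiperfect A ->
  isomorphic (mod_jacobson A : lmodType A) L ->
  projective_cover p -> short_exact i p -> ext1_zero N N -> projective N.
Proof.
move=> noethA perfA /isomorphicP[f [f_inj fS]] pc ip ext.
have [projP _ _] := pc; have [i_inj _ _ pS] := ip.
have fgL := fin_gen_image (mod_jacobson_fin_gen A) fS.
have fgN := noetherian_fin_gen noethA (projective_cover_fin_gen pc fgL) i_inj.
have [Q [q qc]] := perfA _ fgN; have [projQ /surjP qS _] := qc.
have fgQ := projective_cover_fin_gen qc fgN.
have [n [phi [g gE]]] := dual_basis projQ fgQ.
pose pi := pi_jac A.
have kill (u : {linear Q -> mod_jacobson A}) x : q x = 0 -> u x = 0.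
  move=> /(projective_cover_ker qc fgN).
  exact: (jacobson_mul_kill (@mod_jacobson_annihilator A)).
have /choice[theta thetaE] l : exists th : {linear N -> mod_jacobson A},
    forall y, th (q y) = pi (phi l y).
  by apply: (factor_surj (f := pi \o phi l)) => // x; exact: kill.
have fpiS y : exists x, (f \o pi) x = y.
  by have [z <-] := fS y; have [x <-] := pi_jacobson_surj z; exists x.
(* A comparison of [P] with [A] over A/J, which turns lifts to [P] into maps to [A]. *)
have [v vE] := projP _ _ (f \o pi) p (proj2 (surjP (f \o pi)) fpiS).
have /choice[psi psiE] l : exists ps : {linear N -> A^o},
    forall x, pi (ps x) = theta l x.
  have [ps psE] := ext1_zero_lift ext ip (f \o theta l).
  by exists (v \o ps) => x; apply: f_inj; have := vE (ps x); rewrite psE.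
have hL : linear (fun x => \sum_l (psi l x : A) *: g l).
  move=> a x y; rewrite scaler_sumr -big_split; apply: eq_bigr => l _.
  by rewrite linearP scalerDl scalerA.
pose h : {linear N -> Q} := linear_of hL.
have hqJ y : jacobson_mul (y - h (q y)).
  rewrite {1}[y]gE /h /= -sumrB; apply: submodule_sum => [|l].
    exact: submodule_jacobson_mul.
  rewrite -scalerBl; apply: jacobson_mul_scale; apply/pi_jac_eq0.
  by rewrite -[X in X = 0]/(pi (phi l y - psi l (q y))) linearB psiE thetaE subrr.
have sR (u : {linear Q -> Q}) : submodule (range u) by apply: submodule_image; split.
have hqS y : exists x, (h \o q) x = y.
  suff [x _ <-] : range (h \o q) y by exists x.
  apply: (nakayama fgQ (sR _)) => x; exists (h (q x)), (x - h (q x)).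
  by rewrite subrKC; split=> //; exists x.
have [s sE] := projQ _ _ (h \o q) idfun (proj2 (surjP (h \o q)) hqS).
apply: (projective_iso _ qS projQ); apply: linear_inj => y qy.
(* The endomorphism [h \o q] kills x - s(h(q x)) and is the identity modulo JQ, so this difference
   lies in JQ and Nakayama makes the section [s] onto. *)
have : range s y.
  apply: (nakayama fgQ (sR s)) => x; exists (s (h (q x))), (x - s (h (q x))).
  rewrite subrKC; split=> //; have := hqJ (x - s (h (q x))).
  by rewrite (linearB q) (linearB h) [h (q (s _))]sE subrr subr0.
case=> z _ zy; move: qy; rewrite -zy => qz.
have z0 : h (q (s z)) = z := sE z.
by rewrite -z0 qz !linear0.
Qed.

End Syzygies.

(** * The injective dimensions of the syzygies of A/J *)

Lemma pdim_le_mono (A : pzRingType) (M : lmodType A) m n :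
  (m <= n)%N -> pdim_le m M -> pdim_le n M.
Proof.
move=> mn /proj_resolution_leP dM; apply/proj_resolution_leP.
exact: proj_resolution_le_mono dM.
Qed.

Lemma inj_dim_finite (A : pzRingType) (N : lmodType A) :
  inj_dim N <> infty -> exists k, idim_le k N.
Proof.
case dN: (inj_dim N) => [k|] // _; exists k; apply/inj_dim_leP.
by rewrite dN /=.
Qed.

Theorem proposition2p12 (A : pzRingType)
    (hsemiperfect : semiperfect A) (hnoetherian : noetherian A) :
  [/\ (forall d : nat, gl_dim A = Some d ->
         forall N : lmodType A,
           syzygy d (mod_jacobson A : lmodType A) N -> inj_dim N = gl_dim A),
      (iwanaga_gorenstein A -> gl_dim A = infty ->
         forall (n : nat) (N : lmodType A),
           syzygy n (mod_jacobson A : lmodType A) N -> inj_dim N = infty)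
    & (le_enat (fin_inj_dim A) (Some 1%N) ->
         forall (n : nat) (N : lmodType A),
           syzygy n (mod_jacobson A : lmodType A) N -> ~ zero_module N ->
           inj_dim N = gl_dim A)].
Proof.
have [perfA _] := hsemiperfect; have [noethA _] := hnoetherian.
pose A0 : lmodType A := mod_jacobson A.
have fgA0 : fin_gen A0 := mod_jacobson_fin_gen A.
have idimA0 k : idim_le k A0 -> forall M : lmodType A, pdim_le k M.
  move=> /(idim_le_pdim_le noethA perfA (@mod_jacobson_annihilator A)) dfg.
  exact: (auslander dfg).1.
(* Global dimension bounds every injective dimension, so only the reverse bound remains to be shown
   in (1) and (3). *)
have dimE (N : lmodType A) :
    (forall k, idim_le k N -> forall M : lmodType A, pdim_le k M) ->
    inj_dim N = gl_dim A.
  move=> dN; apply: enat_eqP => k; rewrite inj_dim_leP gl_dim_leP.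
  by split=> [/dN //|dA]; exact: pdim_le_idim_le.
split.
- move=> d glA N syzN; apply: dimE => k dN.
  suff dk : (d <= k)%N by apply/gl_dim_leP; rewrite glA.
  (* A zero syzygy in positive degree d would make the preceding one projective, hence the global
     dimension at most d - 1. *)
  have [N0|N0] := EM (zero_module N); last exact: syzygy_idim_lower syzN N0 dN.
  case: d glA syzN => [//|d] glA [L [P [p [i [syzL [projP pS _] i_inj ip]]]]].
  have /surjP pS' := pS; have [_ ker_p] := (exactP i p).1 ip.
  have projL : projective L.
    apply: (projective_iso _ pS' projP); apply: linear_inj => x /ker_p[y <-].
    by rewrite (N0 y) linear0.
  have dA0 : pdim_le d A0 := syzygy_pdim_le (i := 0) syzL projL.
  have /gl_dim_leP := pdim_mod_jacobson_gl_dim hsemiperfect hnoetherian dA0.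
  by rewrite glA /= ltnn.
- move=> [_ /inj_dim_finite[r dA] _] glA n N syzN.
  apply: contrapT => /inj_dim_finite[k dN].
  (* The maximum is a common bound for the injective dimensions of [A] and [N]. *)
  have /idimA0/gl_dim_leP : idim_le (maxn r k) A0; last by rewrite glA.
  apply: syzygy_idim_le syzN _ => //.
    exact: idim_le_mono (leq_maxl _ _) dA.
  exact: idim_le_mono (leq_maxr _ _) dN.
- move=> /sup_enat_leP finA n N syzN N0; apply: dimE => k dN.
  have dN1 : idim_le 1 N.
    apply/inj_dim_leP/finA; exists N; split=> //.
      exact: syzygy_fin_gen noethA fgA0 syzN.
    by move=> dN_inf; have /inj_dim_leP := dN; rewrite dN_inf.
  have n1 := syzygy_idim_lower syzN N0 dN1; have nk := syzygy_idim_lower syzN N0 dN.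
  case: n n1 nk syzN => [|[|//]] _ nk syzN.
    by apply: idimA0; exact: idim_le_iso syzN dN.
  have [L [P [p [i [isoL pc i_inj ip]]]]] := syzN; have [projP pS _] := pc.
  have ses := short_exactP i_inj ip pS.
  have projN : projective N.
    apply: (first_syzygy_projective noethA perfA isoL pc ses).
    (* Ext^2(L, N) = 0 since N has injective dimension at most 1, and this group is Ext^1(N, N). *)
    exact: (idim_le_ext dN1 L _ _ _ _ ses projP).
  have dA0 : pdim_le 1 A0 := syzygy_pdim_le (i := 0) syzN projN.
  (* Here n = 1, so [nk] says that k is at least 1, and the bound 1 on the global dimension
     suffices. *)
  move=> M; apply: (pdim_le_mono nk).
  exact: pdim_mod_jacobson_gl_dim hsemiperfect hnoetherian dA0 M.
Qed.
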